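(* Let $p\in(0,1)$ and $q\in(0,\infty)$. Let $\phi_{p,q}$ be an edge percolation measure on $\mathbb{Z}^2$ obtained as a weak limit, along a subsequence of $n\to\infty$, of the random-cluster measures $\phi_{\mathbb{T}_n,p,q}$ on the torus graphs $\mathbb{T}_n$, and let $\phi_{p,q}^*$ be its planar dual measure. Let $(\phi_{p,q})_{\mathrm{hp}}$ and $(\phi_{p,q}^* )_{\mathrm{hp}}$ be the marginals of $\phi_{p,q}$ and $\phi_{p,q}^*$ on $\mathbb{Z}\times\mathbb{Z}_{\ge 0}$. Then almost surely the number of infinite clusters in $(\phi_{p,q})_{\mathrm{hp}}$ plus the number of infinite clusters in $(\phi_{p,q}^* )_{\mathrm{hp}}$ is at most $1$ (where a primal configuration $H$ is sampled from $\phi_{p,q}$ and the dual configuration is $H^*$).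
   Context: Here $\mathbb{Z}^2$ denotes the square lattice graph: the Cayley graph of the group $\mathbb{Z}^2$ with generators $(1,0),(0,1)$, with edge set $E(\mathbb{Z}^2)$. A (spanning) subgraph of a graph $G$ corresponds to $\omega\in\{0,1\}^{E(G)}$, where $\omega_e=1$ means $e$ is open (present) and $\omega_e=0$ means $e$ is closed (absent). An edge percolation measure on $G$ is a probability measure on $\{0,1\}^{E(G)}$ (product topology). A cluster is a connected component of the subgraph of open edges; it is infinite if it has infinitely many vertices. For $n\ge 3$, the torus graph $\mathbb{T}_n$ is the Cayley graph of $(\mathbb{Z}/n\mathbb{Z})^2$ with respect to the generators $(1,0),(0,1)$. The random-cluster measure on $\mathbb{T}_n$ (with no boundary) with parameters $p\in(0,1)$, $q\in(0,\infty)$ is the probability measure on $\{0,1\}^{E(\mathbb{T}_n)}$ given by $$\phi_{\mathbb{T}_n,p,q}(\omega)=Z^{-1}\left(\frac{p}{1-p}\right)^{|\omega|}q^{\kappa(\omega)},$$ where $|\omega|$ is the number of open edges of $\omega$, $\kappa(\omega)$ is the number of connected components of $\omega$ (counting isolated vertices), and $Z=Z(n,p,q)>0$ is the normalizing constant. Identify the vertices of $\mathbb{T}_n$ with the integer points of $[-n/2,n/2)^2$, so that each finite edge set of $\mathbb{Z}^2$ is identified with an edge set of $\mathbb{T}_n$ for all large $n$; weak convergence to a measure on $\{0,1\}^{E(\mathbb{Z}^2)}$ means convergence of the marginals on every finite edge set. Such subsequential weak limits exist by compactness. Duality: the planar dual $(\mathbb{Z}^2)^*$ has the plaquettes (unit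 square faces) of $\mathbb{Z}^2$ as vertices, and each edge $e$ of $\mathbb{Z}^2$ corresponds to a dual edge $e^*$ joining the two plaquettes touching $e$. The dual is identified with $\mathbb{Z}^2$ by identifying the vertex $(x,y)$ with the plaquette centered at $(x+1/2,y+1/2)$. The dual $H^*$ of a subgraph $H$ has $e^*$ open if and only if $e$ is closed in $H$. The dual measure $\mu^*$ of an edge percolation measure $\mu$ on $\mathbb{Z}^2$ is the law of $H^*$ when $H$ is sampled from $\mu$, viewed as an edge percolation measure on $\mathbb{Z}^2$ via this identification. For an edge percolation measure $\mu$ on $\mathbb{Z}^2$, $\mu_{\mathrm{hp}}$ denotes its marginal on the upper half-plane $\mathbb{Z}\times\mathbb{Z}_{\ge 0}$ (edges with both endpoints in $\mathbb{Z}\times\mathbb{Z}_{\geq 0}$). *)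

(* Defs.v *)
From HB Require Import structures.
From mathcomp Require Import all_boot all_order all_algebra.
From mathcomp Require Import all_classical all_reals all_analysis.

Set Implicit Arguments.
Unset Strict Implicit.
Unset Printing Implicit Defensive.

Import Order.TTheory GRing.Theory Num.Theory.
Import numFieldNormedType.Exports.

Local Open Scope classical_set_scope.
Local Open Scope ring_scope.

(* The Cayley graph of Z * Z with generators (1,0) and (0,1), used below with
   Z = int (square lattice) and Z = 'Z_n (torus). The pair (u, d) encodes the
   undirected edge between u and u + gen d, horizontal if d = false and vertical
   if d = true. Over 'Z_n this encoding is one-to-one as soon as n >= 3. *)
Definition edge (Z : Type) : Type := (Z * Z * bool)%type.

Definition gen (Z : pzRingType) (d : bool) : Z * Z :=
  if d then (0, 1) else (1, 0).

Definition open_adj (Z : pzRingType) (H : edge Z -> bool) : rel (Z * Z) :=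
  fun u v => [exists d : bool,
    (H (u, d) && (v == u + gen Z d)) || (H (v, d) && (u == v + gen Z d))].

(* Configurations on the square lattice (true = open), with the product
   sigma-algebra. *)
Definition config :=
  g_sigma_algebraType [set A : set (edge int -> bool) |
    exists e b, A = [set H | H e = b]].

(* Note that 'Z_n is the ring of integers mod n only for n >= 2. *)
Definition torus_config (n : nat) := {ffun edge 'Z_n -> bool}.

Definition nb_open n (w : torus_config n) : nat := #|[set e | w e]%SET|.

Definition nb_components n (w : torus_config n) : nat :=
  n_comp (open_adj w) predT.

Definition rc_weight (R : realType) (p q : R) n (w : torus_config n) : R :=
  (p / (1 - p)) ^+ nb_open w * q ^+ nb_components w.

Definition rc_torus (R : realType) (p q : R) n (E : pred (torus_config n)) : R :=
  (\sum_(w : torus_config n | E w) rc_weight p q w) /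
  (\sum_(w : torus_config n) rc_weight p q w).

(* Reduction mod n restricts to a bijection from the integer points of
   [-n/2, n/2)^2 to the vertices of the torus; hence, on any given finite set
   of edges, the n-periodic lift of a torus configuration is, for n large, its
   image under the identification of that edge set with a set of torus edges. *)
Definition edge_mod n (e : edge int) : edge 'Z_n :=
  ((e.1.1%:~R, e.1.2%:~R), e.2).

Definition periodic_lift n (w : torus_config n) : edge int -> bool :=
  fun e => w (edge_mod n e).

Definition agree_on (F : seq (edge int)) (xi H : edge int -> bool) : bool :=
  all (fun e => H e == xi e) F.

(* phi is the weak limit of the torus measures along the subsequence
   n = s 0 < s 1 < ...: for every finite set F of edges, the probability of
   each configuration xi on F converges. *)
Definition rc_torus_weak_limit (R : realType) (p q : R)
    (phi : probability config R) : Prop :=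
  exists s : nat -> nat,
    [/\ {homo s : i j / (i < j)%N},
        forall k, (3 <= s k)%N &
        forall (F : seq (edge int)) (xi : edge int -> bool),
          (rc_torus p q (fun w : torus_config (s k) =>
             agree_on F xi (periodic_lift w)))%:E @[k --> \oo]
          --> phi [set H : config | agree_on F xi H]].

(* The vertex (x, y) also stands for the plaquette centered at
   (x + 1/2, y + 1/2). The horizontal edge {(x, y), (x + 1, y)} touches the
   plaquettes (x, y - 1) and (x, y); the vertical edge {(x, y), (x, y + 1)}
   touches the plaquettes (x - 1, y) and (x, y). *)
Definition dual_edge (e : edge int) : edge int :=
  (e.1 - gen int (~~ e.2), ~~ e.2).

Definition primal_edge (f : edge int) : edge int :=
  (f.1 + gen int f.2, ~~ f.2).

Lemma dual_edgeK : cancel dual_edge primal_edge.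
Proof. by case=> u d; rewrite /primal_edge /= subrK negbK. Qed.

Lemma primal_edgeK : cancel primal_edge dual_edge.
Proof. by case=> u d; rewrite /dual_edge /= negbK addrK. Qed.

Definition dual (H : edge int -> bool) : edge int -> bool :=
  fun f => ~~ H (primal_edge f).

Lemma dualE (H : edge int -> bool) e : dual H (dual_edge e) = ~~ H e.
Proof. by rewrite /dual dual_edgeK. Qed.

Definition in_hp (u : int * int) : bool := 0 <= u.2.

Definition hp_adj (H : edge int -> bool) : rel (int * int) :=
  fun u v => [&& in_hp u, in_hp v & open_adj H u v].

Definition hp_cluster (H : edge int -> bool) (u : int * int) : set (int * int) :=
  [set v | exists2 s, path (hp_adj H) u s & v = last u s].

Definition hp_infinite_clusters (H : edge int -> bool) : set (set (int * int)) :=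
  [set C | infinite_set C /\ exists2 u, in_hp u & C = hp_cluster H u].

Definition nb_hp_infinite_clusters (R : realType) (H : edge int -> bool) : \bar R :=
  counting (hp_infinite_clusters H).

(* Main.v *)
Require Import Defs.
From HB Require Import structures.
From mathcomp Require Import all_boot all_order all_algebra.
From mathcomp Require Import all_classical all_reals all_analysis.
From mathcomp Require Import measurable_realfun zify.
Import Order.TTheory GRing.Theory Num.Theory.
Import numFieldNormedType.Exports.
Local Open Scope classical_set_scope.
Local Open Scope ring_scope.

(** Only two properties of the weak limit matter: it is invariant under the
    translations of the lattice, and it has finite energy (editing finitely many
    edges never gives positive probability to a null event). Both are inherited
    from the torus, where translations preserve the weights and changing one
    edge changes the numbers of open edges and of components by at most one.
    They are checked on cylinders and extended to all events by a monotone class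
    argument ([cylinder_domination]).

    By finite energy, an almost sure property still holds almost surely after
    any finite edit, so that the rest of the argument is deterministic: an
    unwanted configuration is edited into one that violates an almost sure
    property. Two properties suffice.
    - No vertex [w] is a merger, that is, joins two distinct infinite clusters
      of its lexicographic past (the vertices above [w], or on its row and to
      its left). Indeed, when the vertices of an N by N box are revealed in
      lexicographic order, every merger joins two clusters that reach the border
      of the box, so that there are at most O(N) mergers among N * N vertices
      ([merger_count]); by stationarity, mergers have probability zero.
    - The vertices of the boundary line that lie in infinite clusters of the
      half-plane have neither a rightmost nor a leftmost element, for the events
      that this element is at a given place are disjoint and equally likely.

    Planarity enters through [trapped_dual]: an open path of the half-plane
    between two boundary vertices is crossed an odd number of times by the
    vertical half-lines that start at the plaquettes just above the boundary
    between these vertices (off the edges of the path), and this parity is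
    constant on dual clusters. Hence these dual clusters are finite, and so are
    the primal clusters enclosed in the same way.

    Uniqueness. If two infinite clusters touch the boundary line, they occupy
    disjoint stretches of it, and a path dug under the line from the left one to
    the leftmost boundary vertex of the right one creates a merger
    ([boundary_infinite_unique]). Clusters that do not touch the line are first
    brought down to it by an isolated vertical column, which leaves an infinite
    piece of the other cluster ([drop_to_boundary]). The law of the dual
    configuration is stationary with finite energy as well, so that its infinite
    cluster is also unique.

    Coexistence. If there are a primal and a dual infinite cluster, both are
    brought down to the boundary line; the dual one then lies between two
    boundary vertices of the infinite primal cluster, which are joined by an
    open path, hence it is finite ([no_coexistence]). *)

Set Implicit Arguments.
Unset Strict Implicit.
Unset Printing Implicit Defensive.

(** * Connection inside a set of vertices *)

Notation vertex := (int * int)%type.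

Definition adj_in (V : pred vertex) (H : edge int -> bool) : rel vertex :=
  fun u v => [&& V u, V v & open_adj H u v].

Definition conn (V : pred vertex) (H : edge int -> bool) (u : vertex) :
    set vertex :=
  [set v | exists2 s, path (adj_in V H) u s & v = last u s].

Lemma open_adj_sym (Z : pzRingType) (H : edge Z -> bool) :
  symmetric (open_adj H).
Proof.
move=> u v; rewrite /open_adj; apply: eq_existsb => d; exact: orbC.
Qed.

Lemma adj_in_sym V H : symmetric (adj_in V H).
Proof. by move=> u v; rewrite /adj_in open_adj_sym andbCA. Qed.

Lemma open_adjP (Z : pzRingType) (H : edge Z -> bool) u v :
  reflect (exists d, H (u, d) /\ v = u + gen Z d \/
                     H (v, d) /\ u = v + gen Z d)
    (open_adj H u v).
Proof.
apply: (iffP existsP) => [[d /orP[]/andP[? /eqP?]]|[d [[h e]|[h e]]]]; exists d.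
- by left.
- by right.
- by apply/orP; left; rewrite h; apply/eqP.
- by apply/orP; right; rewrite h; apply/eqP.
Qed.

Lemma open_adj_gen (H : edge int -> bool) u d :
  H (u, d) -> open_adj H u (u + gen int d).
Proof. by move=> h; apply/open_adjP; exists d; left. Qed.

Lemma conn_refl V H u : conn V H u u.
Proof. by exists [::]. Qed.

Lemma conn_trans V H u v w : conn V H u v -> conn V H v w -> conn V H u w.
Proof.
move=> [s ps ->] [t pt ->]; exists (s ++ t); last by rewrite last_cat.
by rewrite cat_path ps.
Qed.

Lemma conn_adj V H u v : adj_in V H u v -> conn V H u v.
Proof. by move=> a; exists [:: v] => //=; rewrite a. Qed.

Lemma conn_step V H u v w : conn V H u v -> adj_in V H v w -> conn V H u w.
Proof. by move=> c /conn_adj; exact: conn_trans. Qed.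

(** An invariant of the elementary steps is an invariant of the clusters: this
    induction principle replaces reasoning on paths almost everywhere. *)
Lemma conn_ind V H u (Q : vertex -> Prop) : Q u ->
  (forall v w, conn V H u v -> Q v -> adj_in V H v w -> Q w) ->
  forall v, conn V H u v -> Q v.
Proof.
move=> Qu step v [s ps ->].
elim/last_ind: s ps => [//|s x IH]; rewrite rcons_path last_rcons => /andP[ps a].
by apply: step a; [exists s | exact: IH].
Qed.

Lemma conn_sym V H u v : conn V H u v -> conn V H v u.
Proof.
move=> c; elim/conn_ind: v / c => [|v w _ c a]; first exact: conn_refl.
by apply: conn_trans c; apply: conn_adj; rewrite adj_in_sym.
Qed.

Lemma sub_conn (V V' : pred vertex) (H H' : edge int -> bool) u v :
  (forall x, V x -> V' x) -> (forall e, H e -> H' e) ->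
  conn V H u v -> conn V' H' u v.
Proof.
move=> sV sH c; elim/conn_ind: v / c => [|v w _ c /and3P[v1 v2 a]].
  exact: conn_refl.
apply: conn_step c _; rewrite /adj_in !sV //=.
case/open_adjP: a => d [[h e]|[h e]]; apply/open_adjP; exists d;
  [left|right]; by rewrite sH.
Qed.

Lemma conn_in V H u v : conn V H u v -> V u -> V v.
Proof. by move=> c Vu; elim/conn_ind: v / c => [//|v w _ _ /and3P[]]. Qed.

Lemma infinite_conn_in V H u : infinite_set (conn V H u) -> V u.
Proof.
apply: contra_notT => nVu; apply: (@sub_finite_set _ _ [set u]); last first.
  exact: finite_set1.
move=> v c; elim/conn_ind: v / c => [//|v w _ -> /and3P[]].
by rewrite (negbTE nVu).
Qed.

Lemma infinite_conn V H u v : conn V H u v ->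
  infinite_set (conn V H u) -> infinite_set (conn V H v).
Proof.
move=> c i; apply: sub_infinite_set i => w; apply: conn_trans; exact: conn_sym.
Qed.

Lemma sub_infinite_conn (V V' : pred vertex) (H H' : edge int -> bool) u :
  (forall x, V x -> V' x) -> (forall e, H e -> H' e) ->
  infinite_set (conn V H u) -> infinite_set (conn V' H' u).
Proof. by move=> sV sH; apply: sub_infinite_set => w; exact: sub_conn. Qed.

Definition translate (t : vertex) (H : edge int -> bool) : edge int -> bool :=
  fun e => H (e.1 + t, e.2).

Definition edit (lo lc : seq (edge int)) (H : edge int -> bool) :
    edge int -> bool :=
  fun e => (e \in lo) || (e \notin lc) && H e.

Lemma sub_edit_open lo (H : edge int -> bool) e : H e -> edit lo [::] H e.
Proof. by rewrite /edit /= => ->; rewrite orbT. Qed.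

Lemma edit_close_sub lc (H : edge int -> bool) e : edit [::] lc H e -> H e.
Proof. by case/andP. Qed.

Lemma conn_translate V t H u v :
  conn V (translate t H) u v <-> conn (fun x => V (x - t)) H (u + t) (v + t).
Proof.
split=> c.
  elim/conn_ind: v / c => [|v w _ c /and3P[v1 v2 a]]; first exact: conn_refl.
  apply: conn_step c _; rewrite /adj_in !addrK v1 v2 /=.
  case/open_adjP: a => d [[h ->]|[h ->]]; apply/open_adjP; exists d;
    [left|right]; by rewrite addrAC.
suff: conn V (translate t H) u ((v + t) - t) by rewrite addrK.
elim/conn_ind: (v + t) / c => [|x w _ c /and3P[v1 v2 a]].
  by rewrite addrK; exact: conn_refl.
apply: conn_step c _; rewrite /adj_in v1 v2 /=.
case/open_adjP: a => d [[h ->]|[h ->]]; apply/open_adjP; exists d;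
    [left|right]; by rewrite /translate /= subrK addrAC.
Qed.

Lemma infinite_conn_translate V t H u :
  infinite_set (conn V (translate t H) u) <->
  infinite_set (conn (fun x => V (x - t)) H (u + t)).
Proof.
have e1 : conn (fun x => V (x - t)) H (u + t) `<=`
          (+%R^~ t) @` conn V (translate t H) u.
  move=> v c; exists (v - t); last by rewrite subrK.
  by apply/conn_translate; rewrite subrK.
have e2 : conn V (translate t H) u `<=`
          (+%R^~ (- t)) @` conn (fun x => V (x - t)) H (u + t).
  by move=> v /conn_translate c; exists (v + t); rewrite ?addrK.
by split; apply: contra_not => f;
  [apply: sub_finite_set e2 _|apply: sub_finite_set e1 _]; exact: finite_image.
Qed.

(** * Closing edges and reaching the boundary line *)

(** A vertex that is cut from [u] was reached through the closed edge; the part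
    of the path that follows the last passage through this edge joins it to an
    endpoint. *)
Lemma conn_close_edge V (H : edge int -> bool) (e : edge int) u v : conn V H u v ->
  let H' := edit [::] [:: e] H in
  [\/ conn V H' u v, conn V H' e.1 v | conn V H' (e.1 + gen int e.2) v].
Proof.
move=> c H'; elim/conn_ind: v / c => [|v w _ IH /and3P[v1 v2 a]].
  by apply: Or31; exact: conn_refl.
have [<-|w1] := eqVneq (e.1) w; first by apply: Or32; exact: conn_refl.
have [<-|w2] := eqVneq (e.1 + gen int e.2) w.
  by apply: Or33; exact: conn_refl.
have a' : adj_in V H' v w.
  rewrite /adj_in v1 v2 /=; apply/open_adjP.
  case/open_adjP: a => d [[h E]|[h E]]; exists d; [left|right];
    rewrite /H' /edit /= inE h andbT; split => //; apply/eqP => ee.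
  - by move: w2; rewrite -ee /= E eqxx.
  - by move: w1; rewrite -ee /= eqxx.
by case: IH => c; [apply: Or31|apply: Or32|apply: Or33]; apply: conn_step c a'.
Qed.

(** Closing finitely many edges cuts a cluster into finitely many pieces, one of
    which keeps infinitely many of the points of interest. *)
Lemma infinite_conn_close V (H : edge int -> bool) lc (T : set vertex) u :
  infinite_set (T `&` conn V H u) ->
  exists2 u', conn V H u u' &
    infinite_set (T `&` conn V (edit [::] lc H) u').
Proof.
move=> inf; have [u' inf'] : exists u', infinite_set
    (T `&` conn V H u `&` conn V (edit [::] lc H) u').
  elim: lc => [|e lc [u' IH]]; first by exists u; rewrite -setIA setIid.
  set H1 := edit [::] lc H in IH *; set H2 := edit [::] (e :: lc) H.
  have H2E : H2 = edit [::] [:: e] H1.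
    by apply/funext => x; rewrite /H2 /H1 /edit /= !inE negb_or andbA.
  set S := T `&` _ in IH *.
  apply/not_existsP => fin; apply: IH.
  apply: (@sub_finite_set _ _ (S `&` conn V H2 u' `|` (S `&` conn V H2 e.1 `|`
      S `&` conn V H2 (e.1 + gen int e.2)))).
    move=> v [Sv /(conn_close_edge e)]; rewrite -H2E.
    by case=> c; [left|right; left|right; right].
  rewrite !finite_setU; split; last split; apply: contrapT; exact: fin.
have [v [[_ uv] vu']] := infinite_setN0 inf'.
exists u'.
  apply: conn_trans uv _; apply: conn_sym; apply: sub_conn vu' => // x.
  exact: edit_close_sub.
by apply: sub_infinite_set inf' => w [[]].
Qed.

Lemma finite_column (x y : int) :
  finite_set [set v : vertex | v.1 = x /\ 0 <= v.2 < y].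
Proof.
apply: (@sub_finite_set _ _ [set` [seq (x, n%:Z) | n <- iota 0 `|y|%N]]).
  move=> [a b] /= [-> /andP[b0 by_]]; apply/mapP; exists `|b|%N; last first.
    by rewrite gez0_abs.
  by rewrite mem_iota /=; lia.
exact: finite_seq.
Qed.

Lemma lowest_in_column (C : set vertex) (x y : int) : 0 <= y -> C (x, y) ->
  exists y' : int, [/\ 0 <= y', C (x, y') & forall z : int, 0 <= z < y' -> ~ C (x, z)].
Proof.
move=> y0 Cy; have ex : exists n : nat, `[< C (x, n%:Z) >].
  by exists `|y|%N; apply/asboolP; rewrite gez0_abs.
exists (ex_minn ex)%:Z; case: ex_minnP => n /asboolP Cn nmin; split => // z zn.
move=> Cz; have /nmin : `[< C (x, `|z|%N%:Z) >].
  by apply/asboolP; rewrite gez0_abs//; lia.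
lia.
Qed.

(** Closing [shaft_sides x y] isolates the vertices below [(x, y)] in its
    column; opening [shaft x y] then hangs them all on [(x, y)], and on nothing
    else. *)
Definition shaft (x y : int) : seq (edge int) :=
  [seq ((x, n%:Z), true) | n <- iota 0 `|y|%N].

Definition shaft_sides (x y : int) : seq (edge int) :=
  flatten [seq [:: ((x, n%:Z), true); ((x, n%:Z), false);
                   ((x - 1, n%:Z), false)] | n <- iota 0 `|y|%N].

Lemma mem_shaft x y (e : edge int) : 0 <= y ->
  (e \in shaft x y) = [&& e.2, e.1.1 == x & 0 <= e.1.2 < y].
Proof.
move=> y0; case: e => [[a b] d] /=; apply/mapP/and3P => [[n]|[-> /eqP-> b0]].
  by rewrite mem_iota => n0 [-> -> ->]; split => //; lia.
exists `|b|%N; first by rewrite mem_iota; lia.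
by rewrite gez0_abs//; lia.
Qed.

Lemma mem_shaft_sides x y (e : edge int) : 0 <= y ->
  (e \in shaft_sides x y) =
  (0 <= e.1.2 < y) && ((e.1.1 == x) || ~~ e.2 && (e.1.1 == x - 1)).
Proof.
move=> y0; case: e => [[a b] d] /=; apply/flattenP/andP.
  move=> [s /mapP[n]]; rewrite mem_iota => n0 ->; rewrite !inE.
  by case/or3P => /eqP[-> -> ->]; rewrite ?eqxx ?orbT; split => //; lia.
move=> [b0 ab]; set f : nat -> seq (edge int) := fun n => [:: _; _; _].
exists (f `|b|%N); first by apply: map_f; rewrite mem_iota; lia.
have -> : f `|b|%N = [:: ((x, b), true); ((x, b), false); ((x - 1, b), false)].
  by rewrite /f gez0_abs//; lia.
by case/orP: ab => [/eqP->|/andP[/negbTE-> /eqP->]]; rewrite !inE;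
  case: d => //; rewrite eqxx ?orbT.
Qed.

Lemma conn_shaft (H : edge int -> bool) x y : 0 <= y ->
  (forall z : int, 0 <= z < y -> H ((x, z), true)) ->
  conn in_hp H (x, y) (x, 0).
Proof.
move=> y0; rewrite -(gez0_abs y0); elim: `|y|%N => [|n IH] h.
  exact: conn_refl.
apply: (@conn_trans _ _ _ (x, n%:Z)); last by apply: IH => z ?; apply: h; lia.
apply: conn_sym; apply: conn_adj; rewrite /adj_in /in_hp /=.
have -> : (x, n.+1%:Z) = (x, n%:Z) + gen int true.
  by rewrite /gen; congr pair => /=; lia.
by apply: open_adj_gen; apply: h; lia.
Qed.

(** The column is dug from the lowest vertex of the cluster of [u] above a given
    abscissa, so that this cluster loses no edge and only gains the column. The
    other cluster may be cut, but one of its pieces is still rich in [T]. *)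
Lemma drop_to_boundary (H : edge int -> bool) u1 u (T : set vertex) :
  infinite_set (conn in_hp H u) ->
  infinite_set (T `&` conn in_hp H u1) -> ~ conn in_hp H u u1 ->
  exists lo lc x u1', let H' := edit lo lc H in
    [/\ infinite_set (conn in_hp H' (x, 0)),
        infinite_set (T `&` conn in_hp H' u1') &
        ~ conn in_hp H' (x, 0) u1'].
Proof.
move=> infu infT nuu1; case: u infu nuu1 => x y infu nuu1.
have y0 : 0 <= y by have := infinite_conn_in infu.
have [y' [y'0 Cy' ymin]] := lowest_in_column y0 (@conn_refl in_hp H (x, y)).
exists (shaft x y'), (shaft_sides x y'), x.
have [u1' u1u1' infT'] := infinite_conn_close (shaft_sides x y') infT.
exists u1'; set H' := edit _ _ _.
have sH' : forall e, edit [::] (shaft_sides x y') H e -> H' e.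
  by move=> e; rewrite /H' /edit /= => ->; rewrite orbT.
have infT'' : infinite_set (T `&` conn in_hp H u1 `&` conn in_hp H' u1').
  apply: sub_infinite_set infT' => v [Tv c]; split.
    split=> //; apply: conn_trans u1u1' _; apply: sub_conn c => // e.
    exact: edit_close_sub.
  exact: sub_conn c.
(* No vertex of the cluster of [(x, y)] lies in the shaft, so that the edges of
   this cluster are untouched. *)
have kept v w : conn in_hp H (x, y) v -> adj_in in_hp H v w ->
    adj_in in_hp H' v w.
  move=> c a; have cw := conn_step c a.
  case/and3P: (a) => v1 v2 /open_adjP[d h]; rewrite /adj_in v1 v2 /=.
  apply/open_adjP; exists d.
  suff K z z' : in_hp z -> in_hp z' ->
      conn in_hp H (x, y) z -> conn in_hp H (x, y) z' ->
      H (z, d) -> z' = z + gen int d -> H' (z, d).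
    by case: h => [[h e]|[h e]]; [left|right]; split => //; move: e; exact: K.
  move=> z0 z'0 cz cz' hz e; rewrite /H' /edit hz andbT; apply/orP; right.
  rewrite mem_shaft_sides//; apply/negP => /andP[/= zy].
  case: z z' cz cz' {z'0 z0 hz} e zy => [z1 z2] [z1' z2'] cz cz' /= e zy.
  case/orP => [/eqP ez|/andP[nd /eqP ez]].
    by move: cz; rewrite ez; exact: ymin.
  by move: e; rewrite /gen (negbTE nd) ez => -[e1 e2]; move: cz';
     rewrite e1 e2 addr0 subrK; exact: ymin.
have cyx : conn in_hp H' (x, y') (x, 0).
  apply: conn_shaft => // z zy.
  by rewrite /H' /edit mem_shaft//= eqxx zy.
have sub v : conn in_hp H (x, y) v -> conn in_hp H' (x, y) v.
  move=> c; elim/conn_ind: v / c => [|v w c c' a]; first exact: conn_refl.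
  by apply: conn_step c' _; exact: kept.
have yx : conn in_hp H' (x, y) (x, 0) by apply: conn_trans cyx; exact: sub.
split.
- apply: infinite_conn yx _; apply: sub_infinite_set infu => v; exact: sub.
- by apply: sub_infinite_set infT'' => v [[]].
(* The new cluster is the old one plus the shaft. *)
move=> xu1'; apply: infT''.
apply: sub_finite_set (finite_column x y') => v [[_ u1v] u1'v].
have {u1'v} c : conn in_hp H' (x, y') v.
  by apply: conn_trans cyx _; apply: conn_trans xu1' _.
suff : conn in_hp H (x, y) v \/ v.1 = x /\ 0 <= v.2 < y'.
  case=> // cv; exfalso; apply: nuu1; apply: conn_trans cv _; exact: conn_sym.
elim/conn_ind: v / c {u1v} => [|v w _ IH /and3P[v1 v2 a]]; first by left.
have E z d z' : in_hp z -> in_hp z' -> H' (z, d) -> z' = z + gen int d ->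
    [\/ H (z, d) /\ ~~ ((z, d) \in shaft_sides x y')
     | z.1 = x /\ z'.1 = x /\ 0 <= z.2 < y' /\ 0 <= z'.2 <= y'].
  move=> z0 z'0; rewrite /H' /edit => /orP[]; last by case/andP; left.
  rewrite mem_shaft//= => /and3P[dt /eqP zx zy] ->; right.
  by rewrite dt /gen /=; split => //; split; [lia|split => //; lia].
have [z [z' [d [hz ez zz]]]] : exists z z' d, [/\ H' (z, d), z' = z + gen int d
    & z = v /\ z' = w \/ z = w /\ z' = v].
  case/open_adjP: a => d [[h e]|[h e]].
    by exists v, w, d; split => //; left.
  by exists w, v, d; split => //; right.
have z0 : in_hp z /\ in_hp z' by case: zz => -[-> ->].
case: (E _ _ _ z0.1 z0.2 hz ez) => [[h n]|[zx [z'x [zy z'y]]]].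
- have nK t : (t = z) \/ (t = z') -> ~ (t.1 = x /\ 0 <= t.2 < y').
    move=> tz [tx ty]; move/negP: n; apply; rewrite mem_shaft_sides //=.
    case: tz => tz; subst t; first by rewrite tx eqxx ty.
    move: tx ty z0; rewrite ez /in_hp; case: (z) => z1 z2; rewrite /gen.
    by case: (d) => /= <- ty [z20 _]; apply/andP; split; lia.
  have av : adj_in in_hp H v w.
    rewrite /adj_in v1 v2; apply/open_adjP; exists d.
    by case: zz => -[? ?]; subst z z'; [left|right].
  case: IH => [c|/nK F]; first by left; apply: conn_step c av.
  by exfalso; apply: F; case: zz => -[? ?]; subst z z'; [left|right].
- have wy : w.1 = x /\ 0 <= w.2 <= y'.
    clear ez; case: zz => -[? ?]; subst z z'; split => //; lia.
  case: wy => wx wy; have [wy'|wy'] := eqVneq w.2 y'.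
    by left; move: Cy'; rewrite -wy' -wx; case: (w).
  by right; split => //; lia.
Qed.

(** * Parity of crossings and enclosed clusters *)

(** [crossing f p q] tells that the step from [p] to [q] crosses the vertical
    half-line above the centre of the plaquette [f]. *)
Definition crossing (f p q : vertex) : bool :=
  [&& p.2 == q.2, f.2 < p.2 &
      (p.1 == f.1) && (q.1 == f.1 + 1) || (q.1 == f.1) && (p.1 == f.1 + 1)].

Fixpoint crossing_parity (f p : vertex) (s : seq vertex) : bool :=
  if s is q :: s' then crossing f p q (+) crossing_parity f q s' else false.

Lemma crossing_sym f p q : crossing f p q = crossing f q p.
Proof.
rewrite /crossing eq_sym orbC; have [->//|//] := eqVneq q.2 p.2.
Qed.

Lemma add_gen_right (a b : int) : (a, b) + gen int false = (a + 1, b).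
Proof. by rewrite /gen; congr pair; rewrite /= addr0. Qed.

Lemma add_gen_up (a b : int) : (a, b) + gen int true = (a, b + 1).
Proof. by rewrite /gen; congr pair; rewrite /= addr0. Qed.

Lemma crossing_horizontal f a b :
  crossing f (a, b) (a + 1, b) = (f.2 < b) && (a == f.1).
Proof.
rewrite /crossing /= eqxx (inj_eq (addIr 1)) andbb; congr (_ && _).
suff -> : (a + 1 == f.1) && (a == f.1 + 1) = false by rewrite orbF.
by apply/negP => /andP[/eqP <- /eqP]; clear; lia.
Qed.

Lemma crossing_vertical f a b : crossing f (a, b) (a, b + 1) = false.
Proof.
rewrite /crossing /=; suff -> : (b == b + 1) = false by [].
by apply/negP => /eqP; clear; lia.
Qed.

Lemma adj_in_hp_ind (H : edge int -> bool) (P : vertex -> vertex -> Prop) :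
  (forall p q, P p q -> P q p) ->
  (forall a b, 0 <= b -> H ((a, b), false) -> P (a, b) (a + 1, b)) ->
  (forall a b, 0 <= b -> H ((a, b), true) -> P (a, b) (a, b + 1)) ->
  forall p q, adj_in in_hp H p q -> P p q.
Proof.
move=> Psym Ph Pv p q /and3P[p0 q0 /open_adjP[d]].
wlog suff W : p q p0 q0 / H (p, d) /\ q = p + gen int d -> P p q.
  by case=> h; [exact: W|apply: Psym; exact: W].
case: p p0 => a b b0 [h ->]; case: d h => h.
  by rewrite add_gen_up; exact: Pv.
by rewrite add_gen_right; exact: Ph.
Qed.

(** Moving the plaquette to the right changes the parity by the number of
    passages through the vertical half-line of vertices that separates the two
    columns, and the two ends of the path lie off this half-line. *)
Lemma crossing_parity_right (H : edge int -> bool) x y p s : 0 <= y ->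
  ~~ H ((x + 1, y), true) -> path (adj_in in_hp H) p s ->
  crossing_parity (x, y) p s (+) crossing_parity (x + 1, y) p s =
  ((p.1 == x + 1) && (y < p.2)) (+)
  (((last p s).1 == x + 1) && (y < (last p s).2)).
Proof.
move=> y0 nH; elim: s p => [|q s IH] p /=; first by rewrite addbb.
case/andP => a /IH{}IH; rewrite addbACA {}IH addbA; congr (_ (+) _).
elim/adj_in_hp_ind: p q / a => [p q|a b b0 h|a b b0 h].
- by rewrite ![crossing _ p q]crossing_sym => <-; rewrite addKb.
- rewrite !crossing_horizontal /= (inj_eq (addIr 1)).
  by case: (a == x); case: (a == x + 1); case: (y < b).
- rewrite !crossing_vertical /=; have [ax|//] := eqVneq a (x + 1).
  have [yb|bny] := eqVneq b y; first by rewrite -ax -yb h in nH.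
  by move/eqP: bny; clear; lia.
Qed.

Lemma crossing_parity_up (H : edge int -> bool) x y p s :
  ~~ H ((x, y + 1), false) -> path (adj_in in_hp H) p s ->
  crossing_parity (x, y) p s = crossing_parity (x, y + 1) p s.
Proof.
move=> nH; elim: s p => [//|q s IH] p /= /andP[a /IH->]; congr (_ (+) _).
elim/adj_in_hp_ind: p q / a => [p q|a b b0 h|a b b0 h].
- by rewrite ![crossing _ p q]crossing_sym.
- rewrite !crossing_horizontal /=; have [ax|] := eqVneq a x; last by rewrite !andbF.
  have [yb|bny] := eqVneq b (y + 1); first by rewrite -ax -yb h in nH.
  by move/eqP: bny; clear; lia.
- by rewrite !crossing_vertical.
Qed.

Lemma crossing_parity_boundary (H : edge int -> bool) x p s :
  ~~ H ((x, 0), false) -> path (adj_in in_hp H) p s ->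
  crossing_parity (x, 0) p s = (p.1 <= x) (+) ((last p s).1 <= x).
Proof.
move=> nH; elim: s p => [|q s IH] p /=; first by rewrite addbb.
case/andP => a /IH->; rewrite addbA; congr (_ (+) _).
elim/adj_in_hp_ind: p q / a => [p q|a b b0 h|a b b0 h].
- by rewrite crossing_sym => <-; rewrite addKb.
- rewrite !crossing_horizontal /=; have [ax|] := eqVneq a x; last first.
    by rewrite andbF => /eqP; clear; lia.
  have [yb|bny] := eqVneq b 0; first by rewrite -ax -yb h in nH.
  by rewrite ax; move/eqP: bny b0; clear; lia.
- by rewrite !crossing_vertical.
Qed.

Lemma finite_crossed p s :
  finite_set [set f : vertex | in_hp f /\ crossing_parity f p s].
Proof.
elim: s p => [|q s IH] p.
  by apply: sub_finite_set (finite_set0 _) => f [].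
apply: (@sub_finite_set _ _ (([set v | v.1 = p.1 /\ 0 <= v.2 < p.2] `|`
  [set v | v.1 = q.1 /\ 0 <= v.2 < p.2]) `|`
  [set f | in_hp f /\ crossing_parity f q s])); last first.
  by rewrite !finite_setU; split => //; split; exact: finite_column.
move=> f [f0 /=]; have [c _|_] := boolP (crossing f p q); last by right.
left; case/and3P: c => _ fp /orP[]/andP[/eqP -> _]; [left|right];
  by split => //; apply/andP.
Qed.

Lemma dual_invariant (H : edge int -> bool) p s u v :
  path (adj_in in_hp H) p s -> p.2 = 0 -> (last p s).2 = 0 ->
  adj_in in_hp (dual H) u v -> crossing_parity u p s = crossing_parity v p s.
Proof.
move=> ps p0 l0; wlog suff gens : / forall d w, in_hp w -> dual H (w, d) ->
    crossing_parity w p s = crossing_parity (w + gen int d) p s.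
  move=> /and3P[u0 v0 /open_adjP[d [[h ->]|[h ->]]]]; first exact: gens.
  by rewrite -gens.
move=> d [x y]; rewrite /in_hp /= => y0; rewrite /dual /primal_edge.
case: d => /=; rewrite ?add_gen_up ?add_gen_right => h.
  exact: crossing_parity_up ps.
have := crossing_parity_right y0 h ps; rewrite p0 l0 !ltNge y0 !andbF /=.
by do 2 case: crossing_parity.
Qed.

(** An open path that starts and ends on the boundary line encloses the
    plaquettes lying above the part of this line that it spans: their dual
    clusters are crossed an odd number of times, hence finite. *)
Lemma trapped_dual (H : edge int -> bool) a b x :
  conn in_hp H (a, 0) (b, 0) -> a <= x < b -> ~~ H ((x, 0), false) ->
  finite_set (conn in_hp (dual H) (x, 0)).
Proof.
move=> [s ps ls] axb nH; apply: sub_finite_set (finite_crossed (a, 0) s).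
move=> v c; suff : in_hp v /\ crossing_parity v (a, 0) s by [].
elim/conn_ind: v / c => [|v w _ [_ cv] avw].
  split => //; rewrite (crossing_parity_boundary nH ps) -ls /=.
  by clear -axb; lia.
split; first by case/and3P: avw.
by rewrite -(dual_invariant ps _ _ avw)// -ls.
Qed.

Lemma trapped_cluster (H : edge int -> bool) a b x :
  conn in_hp H (a, 0) (b, 0) -> a < x < b -> ~ conn in_hp H (a, 0) (x, 0) ->
  finite_set (conn in_hp H (x, 0)).
Proof.
move=> ab axb nax; pose C := conn in_hp H (a, 0).
pose HC : edge int -> bool :=
  fun e => [&& H e, `[< C e.1 >] & `[< C (e.1 + gen int e.2) >]].
have abC : conn in_hp HC (a, 0) (b, 0).
  elim/conn_ind: (b, 0) / ab => [|v w cv c avw]; first exact: conn_refl.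
  apply: conn_step c _; have cw := conn_step cv avw.
  case/and3P: avw => v0 w0 /open_adjP[d h]; rewrite /adj_in v0 w0.
  apply/open_adjP; exists d; rewrite /HC /=.
  by case: h => -[-> e]; [left|right]; rewrite -e; split => //;
    apply/and3P; split => //; apply/asboolP.
have fin : finite_set (conn in_hp (dual HC) (x, 0)).
  apply: trapped_dual abC _ _; first by lia.
  by rewrite /HC; apply/negP => /and3P[_ /asboolP].
apply: sub_finite_set fin => v c.
(* A step off the cluster of [(a, 0)] crosses an edge that is incident to its
   upper or right end, hence not an edge of that cluster. *)
suff : conn in_hp (dual HC) (x, 0) v /\ ~ C v by case.
elim/conn_ind: v / c => [|v w cv [cv' nv] avw].
  by split => //; exact: conn_refl.
have nw : ~ C w.
  by move=> cw; apply: nv; apply: conn_step cw _; rewrite adj_in_sym.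
split => //; apply: conn_step cv' _.
case/and3P: avw => v0 w0 /open_adjP[d h]; rewrite /adj_in v0 w0.
apply/open_adjP; exists d; rewrite /dual /primal_edge /HC /=.
by case: h => -[_ e]; [left|right]; rewrite -e; split => //;
    apply/negP => /and3P[_ /asboolP].
Qed.

(** * Mergers and clusters that touch the boundary line *)

(** The past of [w] consists of the vertices that precede it when the vertices
    are revealed from top to bottom and, on each row, from left to right. *)
Definition past (w : vertex) : pred vertex :=
  fun v => (w.2 < v.2) || (v.2 == w.2) && (v.1 < w.1).

Definition north (w : vertex) : vertex := w + gen int true.
Definition west (w : vertex) : vertex := w - gen int false.

Definition merger (w : vertex) (H : edge int -> bool) : Prop :=
  [/\ H (w, true), H (west w, false),
      infinite_set (conn (past w) H (north w)),
      infinite_set (conn (past w) H (west w)) &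
      ~ conn (past w) H (north w) (west w)].

Lemma past_translate w : (fun x => past 0 (x - w)) = past w.
Proof.
apply/funext => x; rewrite /past /=; congr (_ || (_ && _)).
- by rewrite subr_gt0.
- by rewrite subr_eq0.
- by rewrite subr_lt0.
Qed.

Lemma merger_translate w H : merger w H <-> merger 0 (translate w H).
Proof.
have n : north 0 + w = north w by rewrite /north addrAC add0r addrC.
have s : west 0 + w = west w by rewrite /west addrAC add0r.
rewrite /merger; split => [] [h1 h2 h3 h4 h5]; split.
- by rewrite /translate /= add0r.
- by rewrite /translate /= s.
- by apply/infinite_conn_translate; rewrite past_translate n.
- by apply/infinite_conn_translate; rewrite past_translate s.
- by move/conn_translate; rewrite past_translate n s.
- by move: h1; rewrite /translate /= add0r.
- by move: h2; rewrite /translate /= s.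
- by move/infinite_conn_translate: h3; rewrite past_translate n.
- by move/infinite_conn_translate: h4; rewrite past_translate s.
- by move=> c; apply: h5; apply/conn_translate; rewrite past_translate n s.
Qed.

Lemma int_min (S : set int) (x1 x2 : int) : S x2 ->
  (forall x, S x -> x1 < x) ->
  exists2 m, S m & forall x, S x -> m <= x.
Proof.
move=> S2 lb; have ex : exists n : nat, `[< S (x1 + n%:Z) >].
  exists `|x2 - x1|%N; apply/asboolP; have := lb _ S2.
  by move=> lt; have -> : x1 + `|x2 - x1|%N%:Z = x2 by lia.
exists (x1 + (ex_minn ex)%:Z); case: ex_minnP => n /asboolP Sn nmin //.
move=> x Sx; have lt := lb _ Sx; have := nmin `|x - x1|%N.
have -> : x1 + `|x - x1|%N%:Z = x by lia.
move=> /(_ (asboolT Sx)).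
by clear -lt; lia.
Qed.

(** Two distinct infinite clusters that touch the boundary line would occupy
    disjoint stretches of it, so that the right one has a leftmost boundary
    vertex; a U-shaped path dug below the boundary line up to this vertex would
    then be a merger. *)
Lemma boundary_infinite_unique (H : edge int -> bool) x1 x2 :
  (forall lo w, ~ merger w (edit lo [::] H)) ->
  infinite_set (conn in_hp H (x1, 0)) -> infinite_set (conn in_hp H (x2, 0)) ->
  conn in_hp H (x1, 0) (x2, 0).
Proof.
move=> nomerger; wlog lt12 : x1 x2 / x1 < x2.
  move=> W i1 i2; case: (ltgtP x1 x2) => [lt|lt|->]; last exact: conn_refl.
    exact: W.
  by apply: conn_sym; exact: W.
move=> i1 i2; apply: contrapT => n12.
pose S := [set x | conn in_hp H (x2, 0) (x, 0)].
have lb x : S x -> x1 < x.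
  move=> Sx; case: (ltgtP x1 x) => // [lt|xE]; last first.
    by exfalso; apply: n12; apply: conn_sym; rewrite xE.
  exfalso; apply: i1; apply: (@trapped_cluster _ x x2).
  - exact: conn_sym.
  - by rewrite lt.
  - by move=> c; apply: n12; apply: conn_sym; exact: conn_trans c.
have [m Sm minm] := int_min (@conn_refl _ _ _ : S x2) lb.
have im : infinite_set (conn in_hp H (m, 0)) by exact: infinite_conn i2.
have n1m : ~ conn in_hp H (m, 0) (x1, 0).
  by move=> c; apply: n12; apply: conn_sym; exact: conn_trans c.
have lt1m := lb _ Sm; pose w : vertex := (m, -1).
pose lo : seq (edge int) := ((x1, -1), true) :: ((m, -1), true) ::
  [seq ((x1 + n%:Z, -1), false) | n <- iota 0 `|m - x1|%N].
apply: (nomerger lo w); set H' := edit lo [::] H.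
have HH' e : H e -> H' e by exact: sub_edit_open.
have hp_past v : in_hp v -> past w v by rewrite /in_hp /past /=; lia.
have rowE (x : int) : x1 <= x < m -> H' ((x, -1), false).
  move=> x1m; rewrite /H' /edit !inE; apply/orP; left; apply/or3P/Or33.
  by apply/mapP; exists `|x - x1|%N; [rewrite mem_iota; lia|];
    congr ((_, _), _); lia.
have nw : north w = (m, 0) by rewrite /north add_gen_up.
have ww : west w = (m - 1, -1) by rewrite /west /gen; congr pair; lia.
have iw : infinite_set (conn (past w) H' (x1, 0)).
  by apply: sub_infinite_conn i1.
have row : forall n : nat, x1 + n%:Z < m ->
    conn (past w) H' (x1, 0) (x1 + n%:Z, -1).
  elim=> [|n IH] lt.
    apply: conn_sym; apply: conn_adj; apply/and3P; split; [by rewrite /past /=; lia|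
      by rewrite /past /=; lia|].
    have -> : (x1, 0) = (x1 + 0, -1) + gen int true.
      by rewrite add_gen_up addr0.
    by apply: open_adj_gen; rewrite addr0 /H' /edit !inE eqxx.
  apply: conn_step (IH _) _; first by lia.
  apply/and3P; split; [by rewrite /past /=; lia|by rewrite /past /=; lia|].
  have -> : (x1 + n.+1%:Z, -1) = (x1 + n%:Z, -1) + gen int false.
    by rewrite add_gen_right; congr pair; lia.
  by apply: open_adj_gen; apply: rowE; lia.
have {row} rowW : conn (past w) H' (x1, 0) (m - 1, -1).
  have := row `|(m - 1 - x1)%R|%N; have -> : x1 + `|(m - 1 - x1)%R|%N%:Z = m - 1 by lia.
  by apply; lia.
rewrite /merger nw ww; split.
- by rewrite /H' /edit !inE eqxx orbT.
- by apply: rowE; lia.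
- exact: sub_infinite_conn im.
- exact: infinite_conn rowW iw.
- (* The cluster of [(m, 0)] has not changed: it has no boundary vertex on the
     left of [m]. *)
  move=> cw; suff : conn in_hp H (m, 0) (m - 1, -1).
    by move/conn_in => /(_ isT).
  elim/conn_ind: (m - 1, -1) / cw => [|v v' _ c /and3P[_ pv' a]].
    exact: conn_refl.
  have v0 := conn_in c isT; have v'0 : in_hp v'.
    case: v v' c v0 pv' a => [a b] [a' b'] c v0 pv' /open_adjP[d h].
    apply: contraT; rewrite /in_hp -ltNge /= => lt.
    move: pv'; rewrite /past /= => pv'.
    have [eb' lt'] : b' = -1 /\ a' < m by clear -pv' lt; lia.
    have {h} [ea eb] : a = a' /\ b = b' + 1.
      move: v0 h; rewrite /in_hp /= eb'; clear; rewrite /gen.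
      by case: d => b0 [[_ []]|[_ []]] /=; lia.
    have := minm a; rewrite /S /= => mina.
    suff : m <= a by clear -ea lt'; lia.
    apply: mina; apply: conn_trans Sm _; suff -> : (a, 0) = (a, b) by [].
    by rewrite eb eb'.
  apply: conn_step c _; rewrite /adj_in v0 v'0.
  have K z d : in_hp z -> H' (z, d) -> H (z, d).
    rewrite /H' /edit !inE /= => z0 /orP[|//]; rewrite /in_hp in z0.
    case/or3P => [/eqP[e _]|/eqP[e _]|/mapP[n _ [e _]]];
      by move: z0; rewrite e.
  case/open_adjP: a => d [[h e]|[h e]]; apply/open_adjP; exists d;
    [left|right]; by split => //; exact: K.
Qed.

(** * Uniqueness in configurations that stay regular under finite edits *)

Lemma edit_edit lo lc lo' lc' H :
  edit lo' lc' (edit lo lc H) =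
  edit (lo' ++ [seq e <- lo | e \notin lc']) (lc' ++ lc) H.
Proof.
apply/funext => e; rewrite /edit !mem_cat mem_filter negb_or.
by rewrite andb_orr -orbA !andbA.
Qed.

Lemma edit_nil H : edit [::] [::] H = H.
Proof. by apply/funext. Qed.

(** Finite energy turns every almost sure property into an almost sure property
    of this kind, which deterministic constructions can use freely. *)
Definition robustly (P : (edge int -> bool) -> Prop) (H : edge int -> bool) :=
  forall lo lc, P (edit lo lc H).

Lemma robustly_edit P lo lc H : robustly P H -> robustly P (edit lo lc H).
Proof. by move=> rP lo' lc'; rewrite edit_edit. Qed.

Lemma robustly_here (P : (edge int -> bool) -> Prop) H : robustly P H -> P H.
Proof. by move/(_ [::] [::]); rewrite edit_nil. Qed.

Definition boundary_infinite (H : edge int -> bool) : set int :=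
  [set x | infinite_set (conn in_hp H (x, 0))].

Definition beyond (right : bool) (x y : int) : bool :=
  if right then x < y else y < x.

Definition extremal (right : bool) (x : int) (H : edge int -> bool) : Prop :=
  boundary_infinite H x /\
  forall y, beyond right x y -> ~ boundary_infinite H y.

Definition regular (H : edge int -> bool) : Prop :=
  (forall w, ~ merger w H) /\ forall right x, ~ extremal right x H.

Lemma regular_beyond H right x : regular H -> boundary_infinite H x ->
  exists2 y, beyond right x y & boundary_infinite H y.
Proof.
move=> [_ /(_ right x) next] Ix; apply: contrapT => no; apply: next.
by split=> // y xy Iy; apply: no; exists y.
Qed.

Lemma regular_unbounded H right x a : regular H -> boundary_infinite H x ->
  exists2 z, boundary_infinite H z & beyond right a z.
Proof.
move=> rH Ix; apply: contrapT => no.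
have bd y : boundary_infinite H y -> ~~ beyond right a y.
  by move=> Iy; apply/negP => ay; apply: no; exists y.
pose opp z : int := if right then - z else z.
have oppK z : opp (opp z) = z by rewrite /opp; case: (right); rewrite ?opprK.
have [||m Sm minm] :=
    @int_min [set y | boundary_infinite H (opp y)] (opp a - 1) (opp x).
- by rewrite /= oppK.
- by move=> y /bd; rewrite /beyond /opp; case: (right); clear; lia.
have [y my Iy] := regular_beyond right rH Sm.
have := minm (opp y); rewrite /= oppK => /(_ Iy); move: my.
by rewrite /beyond /opp; case: (right); clear; lia.
Qed.

Lemma regular_infinite H x : regular H -> boundary_infinite H x ->
  infinite_set (boundary_infinite H).
Proof.
move=> rH Ix /finite_seqP[s Is].
have [y + ly] := regular_unbounded true (\sum_(z <- s) `|z|) rH Ix.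
rewrite Is /= => ys; move: ly; rewrite /beyond (big_rem y ys) /= ltNge.
by rewrite (le_trans (ler_norm y))// lerDl sumr_ge0.
Qed.

Lemma robust_boundary_unique H x1 x2 : robustly regular H ->
  boundary_infinite H x1 -> boundary_infinite H x2 ->
  conn in_hp H (x1, 0) (x2, 0).
Proof.
move=> rH; apply: boundary_infinite_unique => lo w.
by have [nm _] := rH lo [::]; exact: nm.
Qed.

(** Since the boundary vertices in infinite clusters have no extremal element
    and all lie in one cluster, that cluster has infinitely many of them. *)
Lemma boundary_cluster_infinite H x : robustly regular H ->
  boundary_infinite H x ->
  infinite_set ([set v : vertex | v.2 = 0] `&` conn in_hp H (x, 0)).
Proof.
move=> rH Ix fin; apply: (regular_infinite (robustly_here rH) Ix).
apply: sub_finite_set (finite_image fst fin) => y Iy.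
by exists (y, 0) => //; split => //; exact: robust_boundary_unique Ix Iy.
Qed.

Lemma infinite_cluster_unique H u1 u2 : robustly regular H ->
  infinite_set (conn in_hp H u1) -> infinite_set (conn in_hp H u2) ->
  conn in_hp H u1 u2.
Proof.
move=> rH i1 i2; apply: contrapT => n12.
(* A first cluster is brought down to the boundary line, where it takes
   infinitely many vertices; a second one is then brought down next to it. *)
have [lo [lc [x [u [ix iu nxu]]]]] : exists lo lc x u,
    let H' := edit lo lc H in
    [/\ infinite_set (conn in_hp H' (x, 0)), infinite_set (conn in_hp H' u) &
        ~ conn in_hp H' (x, 0) u].
  have i22 : infinite_set (setT `&` conn in_hp H u2) by rewrite setTI.
  have [lo [lc [x [u]]]] := drop_to_boundary i1 i22 n12.
  by move=> /= [h1]; rewrite setTI => h2 h3; exists lo, lc, x, u.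
have {rH} rH := robustly_edit lo lc rH.
set H1 := edit lo lc H in rH ix iu nxu.
have infT := boundary_cluster_infinite rH ix.
have nux : ~ conn in_hp H1 u (x, 0).
  by move=> c; apply: nxu; exact: conn_sym.
have [lo' [lc' [x' [u' /= [ix' iu' []]]]]] := drop_to_boundary iu infT nux.
have [[y y'] /= [y0 c]] := infinite_setN0 iu'.
rewrite y0 in c; apply: conn_trans (conn_sym c).
apply: robust_boundary_unique (robustly_edit lo' lc' rH) ix' _.
apply: infinite_conn c _; apply: sub_infinite_set iu' => v.
by case.
Qed.

Lemma dual_edit_open lo H : dual (edit lo [::] H) =
  edit [::] [seq dual_edge e | e <- lo] (dual H).
Proof.
apply/funext => f; rewrite /dual /edit /= negb_or; congr (~~ _ && _).
by rewrite -{2}(primal_edgeK f) mem_map//; exact: can_inj dual_edgeK.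
Qed.

(** If both infinite clusters existed, opening a vertical segment would bring
    the primal one to the boundary line, and closing the edges below a plaquette
    would bring the dual one to it, between two vertices of the primal one. *)
Lemma no_coexistence H u f : robustly regular H ->
  infinite_set (conn in_hp H u) -> infinite_set (conn in_hp (dual H) f) ->
  False.
Proof.
case: u => x y rH iu idf; have y0 : 0 <= y by exact: (infinite_conn_in iu).
pose H1 := edit (shaft x y) [::] H.
have rH1 : robustly regular H1 by exact: robustly_edit.
have Ix : boundary_infinite H1 x.
  have c : conn in_hp H1 (x, y) (x, 0).
    by apply: conn_shaft => // z zy; rewrite /H1 /edit mem_shaft//= eqxx zy.
  apply: infinite_conn c _; apply: sub_infinite_conn iu => // e.
  exact: sub_edit_open.
have [[a b] idf1] : exists f1, infinite_set (conn in_hp (dual H1) f1).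
  have idfT : infinite_set (setT `&` conn in_hp (dual H) f) by rewrite setTI.
  have [f1 _] := infinite_conn_close [seq dual_edge e | e <- shaft x y] idfT.
  by rewrite -dual_edit_open setTI; exists f1.
have b0 : 0 <= b by exact: (infinite_conn_in idf1).
pose lc : seq (edge int) := [seq ((a, n%:Z), false) | n <- iota 0 `|b|.+1].
have mem_lc z : 0 <= z <= b -> ((a, z), false) \in lc.
  move=> zb; apply/mapP; exists `|z|%N; first by rewrite mem_iota; lia.
  by congr ((_, _), _); lia.
have [[x2 z2] _ infS] := infinite_conn_close lc (boundary_cluster_infinite rH1 Ix).
set H2 := edit [::] lc H1 in infS.
have rH2 : robustly regular H2 by exact: robustly_edit.
have [x0 Ix0] : exists x0, boundary_infinite H2 x0.
  have [[y1 y2] [/= -> c]] := infinite_setN0 infS.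
  exists y1; apply: infinite_conn c _.
  by apply: sub_infinite_set infS => v [].
have dualH2 e : dual H1 e -> dual H2 e.
  by rewrite /dual; apply: contra; exact: edit_close_sub.
have ida : infinite_set (conn in_hp (dual H2) (a, 0)).
  have : infinite_set (conn in_hp (dual H2) (a, b)).
    exact: sub_infinite_conn idf1.
  apply: infinite_conn; apply: conn_shaft => // z zb.
  rewrite /dual /primal_edge add_gen_up /H2 /edit /= negb_and negbK.
  by rewrite mem_lc//; lia.
have nHa : ~~ H2 ((a, 0), false) by rewrite /H2 /edit /= mem_lc.
have [z1 I1 az1] := regular_unbounded false a (robustly_here rH2) Ix0.
have [z3 I3 az3] := regular_unbounded true a (robustly_here rH2) Ix0.
apply: ida; apply: trapped_dual nHa.
  exact: (robust_boundary_unique rH2 I1 I3).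
by apply/andP; split; [exact: ltW|].
Qed.

(** * Measurability *)

Definition measurable_event (Q : config -> Prop) : Prop :=
  measurable ([set H | Q H] : set config).

Lemma measurable_event_ext (Q Q' : config -> Prop) :
  (forall H, Q H <-> Q' H) -> measurable_event Q -> measurable_event Q'.
Proof.
move=> QQ'; rewrite /measurable_event; suff -> : Q = Q' by [].
by apply/funext => H; apply/propext.
Qed.

Lemma measurable_event_const (Q : Prop) : measurable_event (fun=> Q).
Proof.
have [q|nq] := pselect Q.
  by apply: (@measurable_event_ext (fun=> True)) => //; exact: measurableT.
by apply: (@measurable_event_ext (fun=> False)) => //; exact: measurable0.
Qed.

Lemma measurable_event_not Q :
  measurable_event Q -> measurable_event (fun H => ~ Q H).
Proof. by move=> mQ; exact: (measurableC mQ). Qed.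

Lemma measurable_event_and Q Q' : measurable_event Q -> measurable_event Q' ->
  measurable_event (fun H => Q H /\ Q' H).
Proof. by move=> mQ mQ'; exact: (measurableI _ _ mQ mQ'). Qed.

Lemma measurable_event_or Q Q' : measurable_event Q -> measurable_event Q' ->
  measurable_event (fun H => Q H \/ Q' H).
Proof. by move=> mQ mQ'; exact: (measurableU _ _ mQ mQ'). Qed.

Lemma measurable_event_imply Q Q' : measurable_event Q -> measurable_event Q' ->
  measurable_event (fun H => Q H -> Q' H).
Proof.
move=> mQ mQ'; apply: (@measurable_event_ext (fun H => ~ Q H \/ Q' H)).
  by move=> H; rewrite -implyE.
by apply: measurable_event_or => //; exact: measurable_event_not.
Qed.

Lemma measurable_event_exists (T : countType) (Q : T -> config -> Prop) :
  (forall x, measurable_event (Q x)) ->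
  measurable_event (fun H => exists x, Q x H).
Proof.
move=> mQ; rewrite /measurable_event.
have -> : [set H : config | exists x, Q x H] = \bigcup_x [set H | Q x H].
  by rewrite predeqE => H; split => [[x ?]|[x _ ?]]; exists x.
by apply: countable_bigcupT_measurable => //; exact: countableP.
Qed.

Lemma measurable_event_forall (T : countType) (Q : T -> config -> Prop) :
  (forall x, measurable_event (Q x)) ->
  measurable_event (fun H => forall x, Q x H).
Proof.
move=> mQ; apply: (@measurable_event_ext (fun H => ~ exists x, ~ Q x H)).
  move=> H; split => [h x|h [x]]; last by apply.
  by apply: contrapT => nx; apply: h; exists x.
apply: measurable_event_not; apply: measurable_event_exists => x.
exact: measurable_event_not.
Qed.

Lemma measurable_event_edge e b : measurable_event (fun H => H e = b).
Proof. by apply: sub_gen_smallest; exists e, b. Qed.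

Lemma measurable_event_conn V u v : measurable_event (fun H => conn V H u v).
Proof.
apply: (@measurable_event_ext
  (fun H => exists s, path (adj_in V H) u s /\ v = last u s)).
  by move=> H; split=> [[s [? ?]]|[s ? ?]]; exists s.
apply: measurable_event_exists => s.
apply: measurable_event_and; last exact: measurable_event_const.
elim: s u => [|w s IH] u /=; first exact: measurable_event_const.
apply: (@measurable_event_ext
  (fun H => (exists d : bool, (V u /\ V w) /\ (H (u, d) /\ w = u + gen int d \/
    H (w, d) /\ u = w + gen int d)) /\ path (adj_in V H) w s)).
  move=> H /=; split.
    move=> [[d [[Vu Vw] h]] ->]; rewrite andbT /adj_in Vu Vw.
    by apply/open_adjP; exists d.
  by case/andP => /and3P[-> -> /open_adjP[d h]] ->; split => //; exists d.
apply: measurable_event_and => //; apply: measurable_event_exists => d.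
apply: measurable_event_and; first exact: measurable_event_const.
by apply: measurable_event_or; apply: measurable_event_and;
  solve [exact: measurable_event_edge | exact: measurable_event_const].
Qed.

Lemma infinite_set_pickle (T : countType) (A : set T) :
  infinite_set A <-> forall n, exists x, (n <= pickle x)%N /\ A x.
Proof.
split=> [inf n|unb].
  apply: contra_notP inf => no; pose s := [seq (unpickle k : option T) | k <- iota 0 n].
  apply: (@sub_finite_set _ A (Some @^-1` [set` s])); last first.
    apply: finite_preimage; last exact: finite_seq.
    by move=> ? ? _ _ [].
  move=> x Ax /=; apply/mapP; exists (pickle x); last by rewrite pickleK.
  by rewrite mem_iota /= ltnNge; apply/negP => nx; apply: no; exists x.
case/finite_seqP => s As.
have [x []] := unb (\max_(y <- s) pickle y).+1.
rewrite ltnNge As /= => /negP nle xs; apply: nle.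
exact: leq_bigmax_seq.
Qed.

Lemma measurable_event_infinite V u :
  measurable_event (fun H => infinite_set (conn V H u)).
Proof.
apply: (measurable_event_ext
  (fun H => iff_sym (infinite_set_pickle (conn V H u)))).
apply: measurable_event_forall => n; apply: measurable_event_exists => x.
apply: measurable_event_and; first exact: measurable_event_const.
exact: measurable_event_conn.
Qed.

Lemma measurable_event_merger w : measurable_event (merger w).
Proof.
apply: (@measurable_event_ext (fun H => (H (w, true) /\ H (west w, false)) /\
    ((infinite_set (conn (past w) H (north w)) /\
      infinite_set (conn (past w) H (west w))) /\
    ~ conn (past w) H (north w) (west w)))).
  by move=> H; split=> [[[? ?] [[? ?] ?]]|[? ? ? ? ?]].
by do !apply: measurable_event_and; first
  [ exact: measurable_event_edge | exact: measurable_event_infinite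
  | apply: measurable_event_not; exact: measurable_event_conn].
Qed.

Lemma measurable_event_extremal right x : measurable_event (extremal right x).
Proof.
apply: measurable_event_and; first exact: measurable_event_infinite.
apply: measurable_event_forall => y.
apply: measurable_event_imply; first exact: measurable_event_const.
by apply: measurable_event_not; exact: measurable_event_infinite.
Qed.

Lemma measurable_config_map (T : config -> config) :
  (forall e, measurable_event (fun H => T H e)) -> measurable_fun setT T.
Proof.
move=> mT; apply: (@measurability _ _ config config setT T [set A : set (edge int -> bool)
    | exists e b, A = [set H | H e = b]]) => // A [_ [e [b ->]] <-].
rewrite setTI; case: b; first exact: mT.
apply: (@measurable_event_ext (fun H => ~ T H e)); last first.
  by apply: measurable_event_not; exact: mT.
by move=> H; split; [move/negP/negbTE|move=> h; apply/negP/negbT].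
Qed.

Lemma measurable_translate t :
  measurable_fun [set: config] (translate t : config -> config).
Proof. by apply: measurable_config_map => e; exact: measurable_event_edge. Qed.

Lemma measurable_edit lo lc :
  measurable_fun [set: config] (edit lo lc : config -> config).
Proof.
apply: measurable_config_map => e; rewrite /edit.
case: (e \in lo) => /=; first exact: measurable_event_const.
case: (e \notin lc) => /=; first exact: measurable_event_edge.
exact: measurable_event_const.
Qed.

Lemma measurable_dual : measurable_fun [set: config] (dual : config -> config).
Proof.
apply: measurable_config_map => e; rewrite /dual.
apply: (@measurable_event_ext (fun H => H (primal_edge e) = false)).
  by move=> H; split=> [->|/negbTE].
exact: measurable_event_edge.
Qed.

(** * Counting mergers in a box *)

Definition in_box (N : nat) (v : vertex) : bool :=
  (0 <= v.1 <= N.+1%:Z) && (0 <= v.2 <= N.+1%:Z).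

Definition box_interior (N : nat) : seq vertex :=
  [seq (i.+1%:Z, j.+1%:Z) | i <- iota 0 N, j <- iota 0 N].

Definition box_border (N : nat) : seq vertex :=
  flatten [seq [:: (i%:Z, 0); (i%:Z, N.+1%:Z); (0, i%:Z); (N.+1%:Z, i%:Z)]
          | i <- iota 0 N.+2].

Lemma size_box_border N : size (box_border N) = (4 * N.+2)%N.
Proof.
rewrite size_flatten /shape -map_comp -[in RHS](size_iota 0 N.+2).
by elim: (iota 0 N.+2) => //= _ s ->; rewrite mulnS.
Qed.

Lemma mem_box_border N v :
  (v \in box_border N) = in_box N v &&
  [|| v.1 == 0, v.1 == N.+1%:Z, v.2 == 0 | v.2 == N.+1%:Z].
Proof.
case: v => a b; apply/flattenP/andP.
  move=> [_ /mapP[i iN ->]]; move: iN; rewrite mem_iota /in_box /= => iN.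
  rewrite !inE.
  by case/or4P => /eqP[-> ->]; rewrite ?eqxx ?orbT; split => //; clear -iN; lia.
rewrite /in_box /= => -[ab e].
pose f (i : nat) : seq vertex :=
  [:: (i%:Z, 0); (i%:Z, N.+1%:Z); (0, i%:Z); (N.+1%:Z, i%:Z)].
have fi (i : nat) : (i <= N.+1)%N ->
    f i \in [seq f i | i <- iota 0 N.+2].
  by move=> iN; apply: map_f; rewrite mem_iota.
have [a' ea] : exists a' : nat, a = a'%:Z by exists `|a|%N; clear -ab; lia.
have [b' eb] : exists b' : nat, b = b'%:Z by exists `|b|%N; clear -ab; lia.
subst a b; have [aN bN] : (a' <= N.+1)%N /\ (b' <= N.+1)%N by clear -ab; lia.
by case/or4P: e => /eqP ->; [exists (f b')|exists (f b')|exists (f a')|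
  exists (f a')]; rewrite ?fi// !inE eqxx ?orbT.
Qed.

Lemma mem_box_interior N v :
  (v \in box_interior N) = in_box N v && (v \notin box_border N).
Proof.
rewrite mem_box_border; case: v => a b; apply/allpairsP/idP => /=.
  by move=> [[i j] [/=]]; rewrite !mem_iota /in_box /= => ? ? [-> ->]; lia.
rewrite /in_box /= => h; exists (`|a|.-1%N, `|b|.-1%N); rewrite /= !mem_iota.
by split; [lia|lia|congr pair; lia].
Qed.

Lemma size_box_interior N : size (box_interior N) = (N * N)%N.
Proof. by rewrite size_allpairs !size_iota. Qed.

Lemma uniq_box_interior N : uniq (box_interior N).
Proof.
apply: allpairs_uniq; rewrite ?iota_uniq//.
by move=> [i j] [i' j'] _ _ [-> ->].
Qed.

Lemma escape_box V H N u : infinite_set (conn V H u) -> in_box N u ->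
  exists2 b, b \in box_border N & conn (predI (in_box N) V) H u b.
Proof.
move=> inf uN; apply: contrapT => no; apply: inf.
apply: (@sub_finite_set _ _ [set` box_interior N ++ box_border N]); last first.
  exact: finite_seq.
move=> v c; suff : in_box N v /\ conn (predI (in_box N) V) H u v.
  case=> vN _; rewrite /= mem_cat mem_box_interior vN /=.
  by case: (v \in box_border N).
elim/conn_ind: v / c => [|v w _ [vN c] a].
  by split => //; exact: conn_refl.
have wN : in_box N w.
  have : v \notin box_border N by apply/negP => vb; apply: no; exists v.
  rewrite mem_box_border vN /=; case/and3P: a => _ _ /open_adjP[d].
  case: v w vN {c} => [a b] [a' b']; rewrite /in_box /= => vN.
  have [->|->] : gen int d = (1, 0) \/ gen int d = (0, 1).
    by case: d; [right|left].
  - by case=> -[_ [e1 e2]]; rewrite ?addr0 in e1 e2; subst; lia.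
  - by case=> -[_ [e1 e2]]; rewrite ?addr0 in e1 e2; subst; lia.
split => //; apply: conn_step c _.
by case/and3P: a => v1 v2 a; apply/and3P; split => //=; apply/andP.
Qed.

Lemma past_total w w' : w != w' -> past w w' || past w' w.
Proof.
by case: w w' => [a b] [a' b']; rewrite xpair_eqE /past /=; clear; lia.
Qed.

Lemma past_trans w w' v : past w' w -> past w v -> past w' v.
Proof.
by case: w w' v => [a b] [a' b'] [a'' b'']; rewrite /past /=; clear; lia.
Qed.

(** The vertices of the box are revealed in the order of [past]. Among the
    revealed clusters that reach the border, each is represented by its first
    border vertex; a merger joins two such clusters, so that one border vertex
    stops being a representative, which happens to it at most once. *)
Lemma merger_count H N :
  (count (fun w => `[< merger w H >]) (box_interior N) <=
   size (box_border N))%N.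
Proof.
pose bd := box_border N; pose ix b := index b bd.
pose rep V b := forall b', b' \in bd -> conn (predI (in_box N) V) H b' b ->
  (ix b <= ix b')%N.
pose past1 w : pred vertex := fun v => (v == w) || past w v.
pose kills w b := [/\ b \in bd, rep (past w) b & ~ rep (past1 w) b].
have kills_ex w : w \in box_interior N -> merger w H -> exists b, kills w b.
  rewrite mem_box_interior => /andP[wN wb] [hn hw infn infw nnw].
  have inN : in_box N (north w) /\ in_box N (west w).
    move: wN wb; rewrite mem_box_border /in_box; case: (w) => a b /=.
    by rewrite !addr0 ?subr0 /=; clear; lia.
  have first u : in_box N u -> infinite_set (conn (past w) H u) ->
      exists b, [/\ b \in bd, rep (past w) b &
        conn (predI (in_box N) (past w)) H u b].
    move=> uN inf; have [b0 b0d c0] := escape_box inf uN.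
    have ex : exists n : nat, `[< exists b, [/\ b \in bd, ix b = n &
        conn (predI (in_box N) (past w)) H u b] >].
      by exists (ix b0); apply/asboolP; exists b0.
    case: (ex_minnP ex) => n /asboolP[b [bb bn c]] nmin.
    exists b; split => // b' b'd c'; rewrite bn; apply: nmin.
    apply/asboolP; exists b'; split => //.
    by apply: conn_trans c _; exact: conn_sym.
  have [bn [bnd repn cn]] := first _ inN.1 infn.
  have [bw [bwd repw cw]] := first _ inN.2 infw.
  have sub1 V : forall v, predI (in_box N) (past w) v ->
      predI (in_box N) (past1 w) v.
    by move=> v /= /andP[->]; rewrite /past1 => ->; rewrite orbT.
  have joined : conn (predI (in_box N) (past1 w)) H bn bw.
    apply: (@conn_trans _ _ _ (north w)).
      by apply: conn_sym; apply: sub_conn cn => //; exact: sub1.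
    apply: (@conn_trans _ _ _ w); last first.
      apply: (@conn_trans _ _ _ (west w)); last first.
        by apply: sub_conn cw => //; exact: sub1.
      apply: conn_sym; apply: conn_adj; apply/and3P; split.
      - by apply: sub1 => //=; rewrite inN.2 (infinite_conn_in infw).
      - by rewrite /= wN /past1 eqxx.
      - by apply/open_adjP; exists false; left; rewrite /west subrK.
    apply: conn_sym; apply: conn_adj; apply/and3P; split.
    - by rewrite /= wN /past1 eqxx.
    - by apply: sub1 => //=; rewrite inN.1 (infinite_conn_in infn).
    - by apply: open_adj_gen.
  have neq : ix bn <> ix bw.
    move=> /(congr1 (nth (0, 0) bd)); rewrite !nth_index// => e.
    apply: nnw; rewrite e in cn.
    have sub2 v : predI (in_box N) (past w) v -> past w v by case/andP.
    apply: (@conn_trans _ _ _ bw); first exact: sub_conn cn.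
    by apply: conn_sym; exact: sub_conn cw.
  case: (ltngtP (ix bn) (ix bw)) => // lt.
  - exists bw; split => // /(_ _ bnd joined); rewrite leqNgt lt //.
  - exists bn; split => // /(_ _ bwd (conn_sym joined)); rewrite leqNgt lt //.
have kills_inj w w' b : kills w b -> kills w' b -> w = w'.
  wlog : w w' / past w' w.
    move=> W k k'; apply/eqP/negPn/negP => /[dup] ne /past_total/orP[p|p].
      by move/eqP: ne; apply; apply/esym; exact: W p k' k.
    by move/eqP: ne; apply; exact: W p k k'.
  move=> p [_ _ dead] [_ rep' _]; exfalso; apply: dead => b' b'd c.
  apply: rep' => //; apply: sub_conn c => // v /andP[/= -> /orP[/eqP->//|]].
  exact: past_trans.
pose kill w := xget (0, 0) (kills w).
set Q := fun w => _; rewrite -size_filter -(size_map kill).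
have killP w : w \in [seq w <- box_interior N | Q w] -> kills w (kill w).
  rewrite mem_filter => /andP[/asboolP mw wN].
  by rewrite /kill; case: xgetP => // no; have [b kb] := kills_ex _ wN mw;
     have := no b.
apply: uniq_leq_size.
  rewrite map_inj_in_uniq ?filter_uniq ?uniq_box_interior//.
  move=> w w' /killP k /killP k' e; rewrite -e in k'; exact: kills_inj k k'.
by move=> _ /mapP[w /killP[kb _ _] ->].
Qed.

(** * Null events of stationary measures *)

Definition stationary (R : realType) (P : probability config R) : Prop :=
  forall t (A : set config), measurable A ->
    P ((translate t : config -> config) @^-1` A) = P A.

(** Insertion and deletion tolerance in qualitative form: the arguments below
    only transport null events. *)
Definition finite_energy (R : realType) (P : probability config R) : Prop :=
  forall lo lc (A : set config), measurable A -> P A = 0%E ->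
    P ((edit lo lc : config -> config) @^-1` A) = 0%E.

(** This is the expectation of the number of vertices [w] of [l] at which the
    event takes place: by stationarity each of them contributes equally. *)
Lemma stationary_count (R : realType) (P : probability config R)
    (Q : config -> Prop) (l : seq vertex) (c : nat) :
  stationary P -> measurable_event Q ->
  (forall H, (count (fun w => `[< Q (translate w H) >]) l <= c)%N) ->
  ((size l)%:R%:E * P [set H | Q H] <= c%:R%:E)%E.
Proof.
move=> sP mQ cQ; pose B w : set config := (translate w : config -> config) @^-1`
  [set H | Q H].
have mB w : measurable (B w).
  by rewrite -[B w]setTI; exact: measurable_translate.
have -> : ((size l)%:R%:E * P [set H | Q H] = \sum_(w <- l) P (B w))%E.
  rewrite (eq_bigr (fun=> P [set H | Q H])) => [|w _]; last exact: sP.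
  elim: (l) => [|w s IH]; first by rewrite big_nil mul0e.
  by rewrite big_cons -IH /= -natr1 EFinD ge0_muleDl ?lee_fin// mul1e addeC.
have -> : (\sum_(w <- l) P (B w) =
    \int[P]_(H in setT) \sum_(w <- l) (\1_(B w) H)%:E)%E.
  rewrite ge0_integral_sum//.
  - by apply: eq_bigr => w _; rewrite integral_indic// setIT.
  - by move=> w; exact/measurable_EFinP/measurable_indic.
have -> : (c%:R%:E = \int[P]_(H in setT) cst c%:R%:E H)%E.
  by rewrite integral_cst// -[LHS]mule1 -(probability_setT P).
apply: ge0_le_integral => //.
- by move=> H _; apply: sume_ge0 => w _; rewrite lee_fin.
- apply: emeasurable_sum => w; exact/measurable_EFinP/measurable_indic.
- move=> H _; rewrite sumEFin lee_fin.
  apply: le_trans (_ : (count (fun w => `[< Q (translate w H) >]) l)%:R <= _).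
    rewrite -sum1_count natr_sum [leRHS]big_mkcond /=; apply: ler_sum => w _.
    rewrite indicE; case: ifPn => [_|/asboolPn nQ]; first by rewrite lern1; case: (_ \in _).
    by rewrite memNset.
  by rewrite ler_nat.
Qed.

(** A stationary event that takes place at a vanishing proportion of the
    vertices of suitable finite sets is null. *)
Lemma stationary_null (R : realType) (P : probability config R)
    (Q : config -> Prop) :
  stationary P -> measurable_event Q ->
  (forall n, exists l c, [/\ (0 < c)%N, (n * c <= size l)%N &
    forall H, (count (fun w => `[< Q (translate w H) >]) l <= c)%N]) ->
  P [set H | Q H] = 0%E.
Proof.
move=> sP mQ hl; have := fin_num_measure P _ mQ.
move=> /fineK; set a := fine _ => aE; rewrite -aE; congr EFin.
have a0 : 0 <= a by rewrite -lee_fin aE.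
apply/eqP; rewrite eq_le a0 andbT; apply/ler_addgt0Pl => e e0; rewrite addr0.
have [l [c [c0 nc cQ]]] := hl (Num.truncn e^-1).+1.
have := stationary_count sP mQ cQ; rewrite -aE -EFinM lee_fin => le.
have c0' : 0 < c%:R :> R by rewrite ltr0n.
have : ((Num.truncn e^-1).+1 * c)%:R * a <= c%:R.
  by apply: le_trans le; rewrite ler_wpM2r// ler_nat.
rewrite natrM mulrAC ger_pMl// => na.
have : e^-1 * a <= 1.
  apply: le_trans na; rewrite ler_wpM2r// ltW// truncnS_gt//.
by rewrite ler_pdivrMl// mulr1.
Qed.

Lemma merger_null (R : realType) (P : probability config R) w :
  stationary P -> P [set H | merger w H] = 0%E.
Proof.
move=> sP; apply: stationary_null sP (measurable_event_merger w) _ => n.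
(* The border has [4 * (N + 2)] vertices, and this [N] makes
   [n * (4 * (N + 2)) <= N * N]. *)
pose N := (4 * n + 8)%N.
exists [seq v - w | v <- box_interior N], (size (box_border N)).
rewrite size_map size_box_interior; split.
- by rewrite size_box_border; lia.
- by rewrite size_box_border /N; nia.
move=> H; rewrite count_map.
rewrite (eq_count (a2 := fun v => `[< merger v H >])); first exact: merger_count.
move=> v /=; apply/asbool_equiv_eq; rewrite merger_translate [X in _ <-> X]merger_translate.
suff -> : translate w (translate (v - w) H) = translate v H by [].
by apply/funext => e; rewrite /translate /= -addrA [w + _]addrC subrK.
Qed.

(** * Almost sure uniqueness *)

Lemma boundary_infinite_translate k x H :
  boundary_infinite (translate (k, 0) H) x <-> boundary_infinite H (x + k).
Proof.
rewrite /boundary_infinite /= infinite_conn_translate.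
suff -> : (fun v : vertex => in_hp (v - (k, 0))) = in_hp by [].
by apply/funext => v; rewrite /in_hp /= subr0.
Qed.

Lemma extremal_translate right k x H :
  extremal right x (translate (k, 0) H) <-> extremal right (x + k) H.
Proof.
rewrite /extremal boundary_infinite_translate.
split=> -[Ix no]; split => // y xy; last first.
  move=> /boundary_infinite_translate; apply: no; move: xy.
  by rewrite /beyond; case: right; rewrite ltrD2r.
have -> : y = y - k + k by rewrite subrK.
rewrite -boundary_infinite_translate; apply: no; move: xy.
by rewrite /beyond; case: right; [rewrite ltrBrDr|rewrite ltrBlDr].
Qed.

Lemma extremal_unique right x y H :
  extremal right x H -> extremal right y H -> x = y.
Proof.
move=> [Ix nx] [Iy ny]; case: (ltgtP x y) => // lt.
- by case: right nx ny => nx ny; [case: (nx y)|case: (ny x)].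
- by case: right nx ny => nx ny; [case: (ny x)|case: (nx y)].
Qed.

(** At most one of the horizontal translates of this event takes place. *)
Lemma extremal_null (R : realType) (P : probability config R) right x :
  stationary P -> P [set H | extremal right x H] = 0%E.
Proof.
move=> sP; apply: stationary_null sP (measurable_event_extremal right x) _.
move=> n; exists [seq (k%:Z, 0) | k <- iota 0 n], 1%N; split => //.
  by rewrite size_map size_iota muln1.
move=> H; rewrite count_map; set p := preim _ _.
suff : (size [seq k <- iota 0 n | p k] <= 1)%N by rewrite size_filter.
have : uniq [seq k <- iota 0 n | p k] by rewrite filter_uniq ?iota_uniq.
have : {in [seq k <- iota 0 n | p k] &, forall i j, i = j}.
  move=> i j; rewrite !mem_filter => /andP[/asboolP ei _] /andP[/asboolP ej _].
  move: ei ej; rewrite !extremal_translate => ei ej.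
  by have := extremal_unique ei ej => /addrI -[].
case: [seq k <- iota 0 n | p k] => [//|i [//|j s]] eqs /=.
by rewrite (eqs i j) ?inE ?eqxx ?orbT.
Qed.

Lemma ae_forall_countable (R : realType) (P : probability config R)
    (T : countType) (Q : T -> config -> Prop) :
  (forall x, {ae P, forall H, Q x H}) -> {ae P, forall H, forall x, Q x H}.
Proof.
move=> aeQ.
have : \forall H \ae P, forall n, if unpickle n is Some x then Q x H else True.
  by apply: ae_foralln => n; case: unpickle => [x|]; [exact: aeQ|exact: aeW].
by apply: filterS => H h x; have := h (pickle x); rewrite pickleK.
Qed.

Lemma ae_robustly (R : realType) (P : probability config R)
    (Q : config -> Prop) :
  finite_energy P -> {ae P, forall H, Q H} -> {ae P, forall H, robustly Q H}.
Proof.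
move=> feP aeQ; apply: ae_forall_countable => lo.
apply: ae_forall_countable => lc; case: aeQ => A [mA A0 QA].
exists ((edit lo lc : config -> config) @^-1` A); split.
- by rewrite -[X in measurable X]setTI; exact: measurable_edit.
- exact: feP.
- by move=> H nQ; exact: QA.
Qed.

Lemma ae_robustly_regular (R : realType) (P : probability config R) :
  stationary P -> finite_energy P -> {ae P, forall H, robustly regular H}.
Proof.
move=> sP feP; apply: ae_robustly => //.
have ae_not (Q : config -> Prop) : measurable_event Q ->
    P [set H | Q H] = 0%E -> {ae P, forall H, ~ Q H}.
  by move=> mQ Q0; exists [set H | Q H]; split => // H; exact: contrapT.
have mer : {ae P, forall H, forall w, ~ merger w H}.
  apply: ae_forall_countable => w; apply: ae_not.
    exact: measurable_event_merger.
  exact: merger_null.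
have ext : {ae P, forall H, forall right x, ~ extremal right x H}.
  apply: ae_forall_countable => right; apply: ae_forall_countable => x.
  apply: ae_not; first exact: measurable_event_extremal.
  exact: extremal_null.
apply: (@filterS2 _ _ (ae_filter_ringOfSetsType P)) mer ext.
by move=> H nm ne; split.
Qed.

Section dual_law.
Variables (R : realType) (P : probability config R).

Definition dual_config : config -> config := dual.

HB.instance Definition _ :=
  isMeasurableFun.Build _ _ config config dual_config measurable_dual.

Definition dual_law : probability config R := distribution P dual_config.

Lemma dual_law_stationary : stationary P -> stationary dual_law.
Proof.
move=> sP t A mA.
change (P (dual_config @^-1` ((translate t : config -> config) @^-1` A)) =
        P (dual_config @^-1` A)).
rewrite -[RHS](sP t); last first.
  by rewrite -[X in measurable X]setTI; exact: measurable_dual.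
congr (P _); apply/funext => H /=; congr (A _); apply/funext => -[u d].
rewrite /dual_config /dual /translate /primal_edge /=.
by rewrite addrAC.
Qed.

Lemma dual_law_finite_energy : finite_energy P -> finite_energy dual_law.
Proof.
move=> feP lo lc A mA A0.
change (P (dual_config @^-1` ((edit lo lc : config -> config) @^-1` A)) = 0%E).
have mdA : measurable ((dual_config : config -> config) @^-1` A).
  by rewrite -[X in measurable X]setTI; exact: measurable_dual.
rewrite -(feP [seq primal_edge e | e <- lc & e \notin lo]
   [seq primal_edge e | e <- lo] _ mdA A0).
congr (P _); apply/funext => H /=; congr (A _); apply/funext => f.
have inj : injective primal_edge := can_inj primal_edgeK.
rewrite /dual_config /edit /dual !mem_map// mem_filter.
by case: (f \in lo); case: (f \in lc); case: (H _).
Qed.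

Lemma ae_dual_law (Q : config -> Prop) :
  {ae dual_law, forall H, Q H} -> {ae P, forall H, Q (dual H)}.
Proof.
case=> A [mA A0 QA]; exists ((dual_config : config -> config) @^-1` A); split.
- by rewrite -[X in measurable X]setTI; exact: measurable_dual.
- exact: A0.
- by move=> H nQ; exact: QA.
Qed.

End dual_law.

Lemma nb_hp_infinite_clusters_eq0 (R : realType) H :
  (forall u, ~ infinite_set (conn in_hp H u)) ->
  nb_hp_infinite_clusters R H = 0%E.
Proof.
move=> none; rewrite /nb_hp_infinite_clusters.
suff -> : hp_infinite_clusters H = set0.
  by rewrite /counting asboolT// fset_set0.
by apply/eqP; apply: contraT => /set0P[C [iC [u _ eC]]]; case: (none u);
  rewrite eC in iC.
Qed.

Lemma nb_hp_infinite_clusters_le1 (R : realType) H :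
  (forall u v, infinite_set (conn in_hp H u) -> infinite_set (conn in_hp H v) ->
    conn in_hp H u v) ->
  (nb_hp_infinite_clusters R H <= 1)%E.
Proof.
move=> uniq; rewrite /nb_hp_infinite_clusters.
have [->|/set0P[C HC]] := eqVneq (hp_infinite_clusters H) set0.
  by rewrite /counting asboolT// fset_set0 lee_fin.
suff -> : hp_infinite_clusters H = [set C].
  by rewrite /counting asboolT// fset_set1 finmap.cardfs1.
apply/seteqP; split => [C' HC'|_ ->//].
case: HC HC' => iC [u _ eC] [iC' [v _ eC']]; subst C C'.
apply/seteqP; split => w; apply: conn_trans; exact: uniq.
Qed.

(** Uniqueness applies to the measure and to its dual law; coexistence is the
    only remaining case. *)
Theorem ae_nb_hp_infinite_clusters_le1 (R : realType)
    (P : probability config R) :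
  stationary P -> finite_energy P ->
  {ae P, forall H : config,
    (nb_hp_infinite_clusters R H + nb_hp_infinite_clusters R (dual H) <= 1)%E}.
Proof.
move=> sP feP; have reg := ae_robustly_regular sP feP.
have dreg := ae_dual_law (ae_robustly_regular (dual_law_stationary sP)
  (dual_law_finite_energy feP)).
apply: (@filterS2 _ _ (ae_filter_ringOfSetsType P)) reg dreg => H rH rdH.
have [[u iu]|no] := pselect (exists u, infinite_set (conn in_hp H u)).
  rewrite [X in (_ + X)%E]nb_hp_infinite_clusters_eq0 ?adde0.
    by apply: nb_hp_infinite_clusters_le1 => v w; exact: infinite_cluster_unique.
  by move=> f idf; exact: no_coexistence rH iu idf.
rewrite nb_hp_infinite_clusters_eq0 ?add0e.
  by apply: nb_hp_infinite_clusters_le1 => v w; exact: infinite_cluster_unique.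
by move=> u iu; apply: no; exists u.
Qed.

(** * Comparison of measures on cylinders *)

Definition cylinder (F : seq (edge int)) (xi : edge int -> bool) :
    set config :=
  [set H : config | agree_on F xi H].

Lemma measurable_cylinder F xi : measurable (cylinder F xi).
Proof.
suff : measurable_event (fun H => agree_on F xi H) by [].
rewrite /agree_on; elim: F => [|e F IH] /=; first exact: measurable_event_const.
apply: (@measurable_event_ext (fun H => H e = xi e /\
  all (fun e => H e == xi e) F)).
  by move=> H; split=> [[-> ->]|/andP[/eqP]]; rewrite ?eqxx.
by apply: measurable_event_and => //; exact: measurable_event_edge.
Qed.

Definition set_edge (e : edge int) (b : bool) (H : edge int -> bool) :
    edge int -> bool :=
  fun f => if f == e then b else H f.

Definition finitely_determined : set (set config) :=
  [set A | exists F : seq (edge int), forall H H' : config,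
     {in F, H =1 H'} -> A H -> A H'].

Lemma finitely_determined_setring : setring finitely_determined.
Proof.
split=> [|A B [F FA] [G GB]|A B [F FA] [G GB]]; first by exists [::].
- exists (F ++ G) => H H' FG [AH|BH]; [left|right].
  + by apply: FA AH => e eF; apply: FG; rewrite mem_cat eF.
  + by apply: GB BH => e eG; apply: FG; rewrite mem_cat eG orbT.
- exists (F ++ G) => H H' FG [AH nBH]; split.
  + by apply: FA AH => e eF; apply: FG; rewrite mem_cat eF.
  + move=> BH'; apply: nBH; apply: GB BH' => e eG.
    by apply/esym; apply: FG; rewrite mem_cat eG orbT.
Qed.

Lemma measurable_finitely_determined :
  (measurable : set (set config)) `<=` <<sr finitely_determined >>.
Proof.
have [sr0 srD srU] := smallest_sigma_ring finitely_determined.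
apply: smallest_sub.
  split => // A sA; apply: srD => //; apply: sub_g_sigma_ring.
  by exists [::].
move=> _ [e [b ->]]; apply: sub_g_sigma_ring; exists [:: e] => H H' ee /= <-.
by apply/esym/ee; rewrite inE.
Qed.

(** It is enough to compare a measure and its image on the cylinders: the
    comparison extends to their finite disjoint unions, and the events for which
    it holds form a monotone class. *)
Lemma cylinder_domination (R : realType) (P : probability config R)
    (T : config -> config) (K : R) :
  measurable_fun setT T -> 0 <= K ->
  (forall F xi, P (T @^-1` cylinder F xi) <= K%:E * P (cylinder F xi))%E ->
  forall A, measurable A -> (P (T @^-1` A) <= K%:E * P A)%E.
Proof.
move=> mT K0 dom.
have mTA (A : set config) : measurable A -> measurable (T @^-1` A).
  by move=> mA; rewrite -[X in measurable X]setTI; exact: mT.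
have split_edge (A : set config) e : measurable A ->
    P A = (P (A `&` [set H | H e = true]) + P (A `&` [set H | H e = false]))%E.
  move=> mA; rewrite -measureU; first last.
  - by rewrite predeqE => H; split=> // -[[_ /= ->] [_]].
  - by apply: measurableI => //; exact: measurable_event_edge.
  - by apply: measurableI => //; exact: measurable_event_edge.
  rewrite -setIUr; congr (P _); rewrite predeqE => H; split=> [AH|[]//].
  by split => //=; case: (H e); [left|right].
have meas_fd A : finitely_determined A -> measurable A /\
    (P (T @^-1` A) <= K%:E * P A)%E.
  move=> [F FA].
  suff gen G xi : (forall H H' : config, {in F ++ G, H =1 H'} -> A H -> A H') ->
      measurable (A `&` cylinder G xi) /\
      (P (T @^-1` (A `&` cylinder G xi)) <= K%:E * P (A `&` cylinder G xi))%E.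
    have := gen [::] xpred0; rewrite cats0 => /(_ FA).
    suff -> : A `&` cylinder [::] xpred0 = A by [].
    by rewrite predeqE => H; split=> [[]//|AH]; split.
  elim: F G xi {FA} => [|e F IH] G xi GA.
    have [Axi|nAxi] := pselect (A xi).
      have -> : A `&` cylinder G xi = cylinder G xi.
        rewrite predeqE => H; split=> [[]//|GH]; split => //.
        apply: GA Axi => e eG; apply/esym/eqP; exact: (allP GH).
      by split; [exact: measurable_cylinder|exact: dom].
    have -> : A `&` cylinder G xi = set0.
      rewrite predeqE => H; split=> // -[AH GH]; apply: nAxi.
      by apply: GA AH => e eG; apply/eqP; exact: (allP GH).
    by rewrite preimage_set0 !measure0 mule0; split.
  have [eG|eG] := boolP (e \in G).
    apply: IH => H H' FG; apply: GA => f; rewrite /= inE => /orP[/eqP->|]; apply: FG.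
    by rewrite mem_cat eG orbT.
  have step b : A `&` cylinder (e :: G) (set_edge e b xi) =
      (A `&` cylinder G xi) `&` [set H | H e = b].
    rewrite -setIA; congr (_ `&` _).
    have agr H : all (fun f => H f == set_edge e b xi f) G =
        all (fun f => H f == xi f) G.
      apply: eq_in_all => f fG; rewrite /set_edge; case: (f =P e) => // fe.
      by rewrite -fe fG in eG.
    rewrite predeqE => H; rewrite /cylinder /agree_on /= agr /set_edge eqxx.
    by split=> [/andP[/eqP ? ?]|[-> /eqP ->]].
  have {}IH b : measurable (A `&` cylinder (e :: G) (set_edge e b xi)) /\
      (P (T @^-1` (A `&` cylinder (e :: G) (set_edge e b xi))) <=
       K%:E * P (A `&` cylinder (e :: G) (set_edge e b xi)))%E.
    apply: IH => H H' FG; apply: GA => f; rewrite /= inE => fF.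
    by apply: FG; move: fF; rewrite !mem_cat inE orbCA.
  have mA : measurable (A `&` cylinder G xi).
    rewrite -[X in measurable X]setIT.
    have -> : [set: config] = [set H | H e = true] `|` [set H | H e = false].
      by rewrite predeqE => H; split=> //= _; case: (H e); [left|right].
    by rewrite setIUr -!step; apply: measurableU; [exact: (IH true).1|exact: (IH false).1].
  split => //; rewrite (split_edge _ e mA) -!step ge0_muleDr//.
  apply: le_trans (leeD (IH true).2 (IH false).2).
  have mT' b := mTA _ (IH b).1.
  apply: le_trans (measureU2 _ (mT' true) (mT' false)).
  apply: le_measure; rewrite ?inE; [exact: mTA|exact: measurableU|].
  move=> H AH.
  by case E : (T H e); [left|right]; rewrite step.
have mono : monotone [set A | measurable A /\ (P (T @^-1` A) <= K%:E * P A)%E].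
  have lim_le (F : (set config)^nat) A : (P \o F @ \oo --> P A)%E ->
      ((fun n => P (T @^-1` F n)) @ \oo --> P (T @^-1` A))%E ->
      (forall n, P (T @^-1` F n) <= K%:E * P (F n))%E ->
      (P (T @^-1` A) <= K%:E * P A)%E.
    move=> PF PTF le; apply: (lee_cvg_to PTF (cvgeZl _ PF)) => //.
    by apply: nearW.
  split=> F Fmon FM; have mF n := (FM n).1.
    have mU : measurable (\bigcup_n F n) by exact: bigcupT_measurable.
    split => //; apply: (lim_le F) => [||n]; last exact: (FM n).2.
      exact: nondecreasing_cvg_mu.
    rewrite preimage_bigcup.
    apply: (@nondecreasing_cvg_mu _ _ _ P (fun n => T @^-1` F n)).
    - by move=> n; exact: mTA.
    - by apply: bigcupT_measurable => n; exact: mTA.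
    - by move=> m n mn; apply/subsetPset => H; have /subsetPset := Fmon _ _ mn; apply.
  have mI : measurable (\bigcap_n F n) by exact: bigcapT_measurable.
  split => //; apply: (lim_le F) => [||n]; last exact: (FM n).2.
    by apply: nonincreasing_cvg_mu => //; rewrite ltey_eq fin_num_measure.
  rewrite preimage_bigcap.
  apply: (@nonincreasing_cvg_mu _ _ _ P (fun n => T @^-1` F n)).
  - by rewrite ltey_eq fin_num_measure//; exact: mTA.
  - by move=> n; exact: mTA.
  - by apply: bigcapT_measurable => n; exact: mTA.
  - by move=> m n mn; apply/subsetPset => H; have /subsetPset := Fmon _ _ mn; apply.
move=> A /measurable_finitely_determined.
by move/(monotone_setring_sub_g_sigma_ring mono finitely_determined_setring meas_fd) => -[].
Qed.

(** * Perturbations of the random-cluster weights on the torus *)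

Lemma connect_ind (T : finType) (e : rel T) x (Q : T -> Prop) : Q x ->
  (forall y z, connect e x y -> Q y -> e y z -> Q z) ->
  forall y, connect e x y -> Q y.
Proof.
move=> Qx step y /connectP[s ps ->].
elim/last_ind: s ps => [//|s z IH]; rewrite rcons_path last_rcons => /andP[ps a].
by apply: step a; [apply/connectP; exists s | exact: IH].
Qed.

(** Components of [e] with distinct roots have images in distinct components of
    [e']. *)
Lemma n_comp_le_inj (T T' : finType) (e : rel T) (e' : rel T') (h : T -> T') :
  connect_sym e -> connect_sym e' ->
  (forall x y, connect e' (h x) (h y) -> connect e x y) ->
  (n_comp e predT <= n_comp e' predT)%N.
Proof.
move=> se se' he; rewrite /n_comp_mem.
rewrite -(card_in_imset (f := fun r => fingraph.root e' (h r))).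
  apply: subset_leq_card; apply/fintype.subsetP => _ /imsetP[r _ ->].
  by rewrite inE /= roots_root.
move=> r1 r2; rewrite !inE /= !andbT => /eqP r1E /eqP r2E.
by move/(fingraph.rootP se')/he/(fingraph.rootP se); rewrite r1E r2E.
Qed.

(** Apart from the component of [u], distinct components of [e] stay distinct
    for [e']. *)
Lemma n_comp_le_succ (T : finType) (e e' : rel T) u :
  connect_sym e -> connect_sym e' ->
  (forall x y, connect e' x y -> connect e x y \/
     connect e u x \/ connect e u y) ->
  (n_comp e predT <= (n_comp e' predT).+1)%N.
Proof.
move=> se se' he; rewrite /n_comp_mem.
rewrite (cardD1 (fingraph.root e u)) -[leqRHS]add1n.
apply: leq_add; first exact: leq_b1.
rewrite -(card_in_imset (f := fingraph.root e')).
  apply: subset_leq_card; apply/fintype.subsetP => _ /imsetP[r _ ->].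
  by rewrite inE /= roots_root.
move=> r1 r2; rewrite !inE /= !andbT.
move=> /andP[n1 /eqP r1E] /andP[n2 /eqP r2E].
move/(fingraph.rootP se')/he => [/(fingraph.rootP se)|[]/(fingraph.rootP se) E].
- by rewrite r1E r2E.
- by rewrite E r1E eqxx in n1.
- by rewrite E r2E eqxx in n2.
Qed.

Section torus.
Variable n : nat.
Implicit Types w : torus_config n.

Let V : finType := ('Z_n * 'Z_n)%type.

Lemma connect_open_sym w : connect_sym (open_adj w).
Proof. by apply: sym_connect_sym; exact: open_adj_sym. Qed.

Lemma nb_components_edge w w' (e : edge 'Z_n) :
  (forall f, f != e -> w f = w' f) ->
  (nb_components w <= (nb_components w').+1)%N.
Proof.
move=> ww'; pose u := e.1; pose v := u + gen 'Z_n e.2.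
apply: (n_comp_le_succ (u := u)); try exact: connect_open_sym.
move=> x y c; have csym := connect_open_sym w.
(* A path that uses the edge [e] starts and ends in the clusters of its
   endpoints. *)
suff : connect (open_adj w) x y \/
    (connect (open_adj w) u x \/ connect (open_adj w) v x) /\
    (connect (open_adj w) u y \/ connect (open_adj w) v y).
  case=> [|[[]xc []yc]]; try by [left|right; left|right; right].
  by left; apply: connect_trans yc; rewrite csym.
elim/connect_ind: y / c => [|y z _ IH a]; first by left; exact: connect0.
have [a'|na'] := boolP (open_adj w y z).
  case: IH => [c|[cx cy]]; first by left; apply: connect_trans (connect1 a').
  right; split => //; case: cy => c; [left|right];
    exact: connect_trans (connect1 a').
have [yE zE] : (y = u \/ y = v) /\ (z = u \/ z = v).
  have same t d : open_adj w y z = false -> w' (t, d) ->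
      (w (t, d) -> open_adj w y z) -> (t, d) = e.
    move=> nwa h wa; apply/eqP; apply: contraFT nwa => ne; apply: wa.
    by rewrite ww'.
  case/open_adjP: a => d [[h E]|[h E]].
    have de : (y, d) = e.
      apply: same (negbTE na') h _ => h'.
      by apply/open_adjP; exists d; left.
    by rewrite /v /u E -de; split; [left|right].
  have de : (z, d) = e.
    apply: same (negbTE na') h _ => h'.
    by apply/open_adjP; exists d; right.
  by rewrite /v /u E -de; split; [right|left].
right; split; last by case: zE => ->; [left|right]; exact: connect0.
case: IH => [c|[]//]; case: yE c => -> c; [left|right]; by rewrite csym.
Qed.

Lemma nb_open_edge w w' (e : edge 'Z_n) :
  (forall f, f != e -> w f = w' f) -> (nb_open w <= (nb_open w').+1)%N.
Proof.
move=> ww'; apply: (@leq_trans #|([set e] :|: [set f | w' f])%SET|).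
  apply: subset_leq_card; apply/fintype.subsetP => f; rewrite !inE.
  by have [->//|fe] := eqVneq f e; rewrite ww'.
by rewrite (leq_trans (leq_card_setU _ _))// cards1 add1n.
Qed.

Definition torus_translate (t : 'Z_n * 'Z_n) w : torus_config n :=
  [ffun e : edge 'Z_n => w (e.1 + t, e.2)].

Lemma torus_translateK t : cancel (torus_translate t) (torus_translate (- t)).
Proof. by move=> w; apply/ffunP => -[u d]; rewrite !ffunE /= addrNK. Qed.

Lemma nb_open_translate t w : nb_open (torus_translate t w) = nb_open w.
Proof.
pose h (e : edge 'Z_n) : edge 'Z_n := (e.1 + t, e.2).
have hinj : injective h.
  apply: (can_inj (g := fun e : edge 'Z_n => (e.1 - t, e.2))) => -[u d].
  by rewrite /h /= addrK.
rewrite /nb_open -[RHS](card_preimset _ hinj).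
by apply: eq_card => e; rewrite !inE ffunE.
Qed.

Lemma nb_components_translate t w :
  nb_components (torus_translate t w) = nb_components w.
Proof.
suff le s (w1 : torus_config n) :
    (nb_components (torus_translate s w1) <= nb_components w1)%N.
  apply: anti_leq; apply/andP; split; first exact: le.
  by have := le (- t) (torus_translate t w); rewrite torus_translateK.
rewrite /nb_components.
apply: (@n_comp_le_inj V V _ _ (fun x : 'Z_n * 'Z_n => x + s));
  [exact: connect_open_sym|exact: connect_open_sym|].
move=> x y c; suff : connect (open_adj (torus_translate s w1)) x (y + s - s).
  by rewrite addrK.
elim/connect_ind: (y + s) / c => [|y' z _ c a]; first by rewrite addrK.
apply: connect_trans c (connect1 _); apply/open_adjP.
case/open_adjP: a => d [[h E]|[h E]]; exists d; [left|right];
  by rewrite ffunE /= subrK h E addrAC.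
Qed.

Definition torus_set (e : edge 'Z_n) (b : bool) w : torus_config n :=
  [ffun f => if f == e then b else w f].

Variables (R : realType) (p q : R).
Hypotheses (hp0 : 0 < p) (hp1 : p < 1) (hq : 0 < q).

Lemma edge_odds_gt0 : 0 < p / (1 - p).
Proof. by rewrite divr_gt0 ?subr_gt0. Qed.

Lemma rc_weight_gt0 w : 0 < rc_weight p q w.
Proof. by rewrite mulr_gt0 ?exprn_gt0 ?edge_odds_gt0. Qed.

Lemma rc_partition_gt0 : 0 < \sum_(w : torus_config n) rc_weight p q w.
Proof.
rewrite (bigD1 [ffun=> false]) //= ltr_pwDl ?rc_weight_gt0 //.
by apply: sumr_ge0 => w _; exact/ltW/rc_weight_gt0.
Qed.

Lemma rc_torus_translate t (E : pred (torus_config n)) :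
  rc_torus p q (fun w => E (torus_translate t w)) = rc_torus p q E.
Proof.
rewrite /rc_torus; congr (_ / _).
rewrite [RHS](reindex_inj (can_inj (torus_translateK t))).
by apply: eq_bigr => w _; rewrite /rc_weight nb_open_translate
  nb_components_translate.
Qed.

End torus.

Lemma expr_le_near (R : realFieldType) (x : R) i j : 0 < x ->
  (i <= j.+1)%N -> (j <= i.+1)%N -> x ^+ i <= (1 + x + x^-1) * x ^+ j.
Proof.
move=> x0 ij ji; have xn0 k : 0 <= x ^+ k by rewrite exprn_ge0 ?ltW.
have xV0 : 0 <= x^-1 by rewrite invr_ge0 ltW.
rewrite !mulrDl mul1r.
have [->|ij'] := eqVneq i j.
  by rewrite -addrA lerDl addr_ge0 ?mulr_ge0 // ltW.
have [->|ij''] := eqVneq i j.+1.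
  by rewrite exprS addrAC lerDr addr_ge0 ?mulr_ge0.
have -> : j = i.+1 by clear -ij ji ij' ij''; lia.
by rewrite exprS mulKf ?gt_eqF// lerDr addr_ge0 ?mulr_ge0 // ltW.
Qed.

(** The bound does not depend on the size of the torus: prescribing the state
    of one edge changes the numbers of open edges and of components by at most
    one. *)
Definition energy_bound (R : realType) (p q : R) : R :=
  2 * ((1 + p / (1 - p) + (p / (1 - p))^-1) * (1 + q + q^-1)).

Lemma sum_comp_le (R : numDomainType) (T : finType) (f : T -> T)
    (E E' : pred T) (F : T -> R) (k : nat) :
  (forall x, E x -> E' (f x)) -> (forall x, 0 <= F x) ->
  (forall y, #|[pred x | f x == y]| <= k)%N ->
  \sum_(x | E x) F (f x) <= k%:R * \sum_(y | E' y) F y.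
Proof.
move=> EE' F0 fib; rewrite (partition_big f E')//= mulr_sumr.
apply: ler_sum => y _; rewrite (eq_bigr (fun=> F y)); last first.
  by move=> x /andP[_ /eqP->].
rewrite sumr_const -[leLHS]mulr_natl ler_wpM2r// ler_nat.
apply: leq_trans (fib y); apply: subset_leq_card; apply/fintype.subsetP => x.
by rewrite !inE => /andP[].
Qed.

Lemma torus_set_fiber n (e : edge 'Z_n) b (w' : torus_config n) :
  (#|[pred w | torus_set e b w == w']| <= 2)%N.
Proof.
apply: (@leq_trans #|[set torus_set e true w'; torus_set e false w']%SET|).
  apply: subset_leq_card; apply/fintype.subsetP => w.
  rewrite inE => /eqP <-.
  have K c : torus_set e c (torus_set e b w) = torus_set e c w.
    by apply/ffunP => f; rewrite !ffunE; case: eqP.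
  have wE : torus_set e (w e) w = w.
    by apply/ffunP => f; rewrite !ffunE; case: eqP => // ->.
  by rewrite !inE !K -{1 3}wE; case: (w e); rewrite eqxx ?orbT.
by rewrite cards2; case: (_ != _).
Qed.

Lemma rc_torus_set n (R : realType) (p q : R) (e : edge 'Z_n) b
    (E E' : pred (torus_config n)) :
  0 < p -> p < 1 -> 0 < q ->
  (forall w, E w -> E' (torus_set e b w)) ->
  rc_torus p q E <= energy_bound p q * rc_torus p q E'.
Proof.
move=> hp0 hp1 hq EE'; rewrite /rc_torus mulrA.
rewrite ler_pM2r ?invr_gt0 ?rc_partition_gt0// /energy_bound.
set C := (_ * (1 + q + _)).
have r0 := edge_odds_gt0 hp0 hp1.
have wt w : rc_weight p q w <= C * rc_weight p q (torus_set e b w).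
  have off f : f != e -> w f = torus_set e b w f by rewrite ffunE => /negbTE->.
  have off' f : f != e -> torus_set e b w f = w f by move/off.
  rewrite /rc_weight /C mulrACA; apply: ler_pM.
  - by rewrite exprn_ge0 // ltW.
  - by rewrite exprn_ge0 // ltW.
  - exact: (expr_le_near r0 (nb_open_edge off) (nb_open_edge off')).
  - exact: (expr_le_near hq (nb_components_edge off) (nb_components_edge off')).
have C0 : 0 <= C by rewrite mulr_ge0 ?addr_ge0 ?invr_ge0// ltW.
apply: le_trans (ler_sum _ (fun w _ => wt w)) _.
rewrite -mulr_sumr [2 * C]mulrC -[leRHS]mulrA ler_wpM2l//.
apply: sum_comp_le => //; last exact: torus_set_fiber.
by move=> w; exact/ltW/rc_weight_gt0.
Qed.

(** * Weak limits *)

Lemma periodic_lift_translate n t (w : torus_config n) :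
  periodic_lift (torus_translate (t.1%:~R, t.2%:~R) w) =
  translate t (periodic_lift w).
Proof.
apply/funext => -[[x y] d].
rewrite /periodic_lift /edge_mod /translate ffunE /=; congr (w (_, _)).
by rewrite !intrD.
Qed.

Definition translate_edges (t : vertex) (F : seq (edge int)) : seq (edge int) :=
  [seq (e.1 + t, e.2) | e <- F].

Lemma agree_on_translate t F xi H :
  agree_on F xi (translate t H) =
  agree_on (translate_edges t F) (translate (- t) xi) H.
Proof.
rewrite /agree_on all_map; apply: eq_all => -[u d] /=.
by rewrite /translate /= addrK.
Qed.

Lemma weak_limit_stationary (R : realType) (p q : R) phi :
  rc_torus_weak_limit p q phi -> stationary phi.
Proof.
move=> [s [_ _ lim]].
have cyl t F xi : phi ((translate t : config -> config) @^-1` cylinder F xi) =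
    phi (cylinder F xi).
  have -> : (translate t : config -> config) @^-1` cylinder F xi =
      [set H : config | agree_on (translate_edges t F) (translate (- t) xi) H].
    by apply/funext => H; rewrite /= /cylinder /= -agree_on_translate.
  pose prob G zeta k : \bar R := (rc_torus p q (fun w : torus_config (s k) =>
    agree_on G zeta (periodic_lift w)))%:E.
  have probE : prob (translate_edges t F) (translate (- t) xi) = prob F xi.
    apply/funext => k; congr EFin.
    rewrite -[RHS](rc_torus_translate p q (t.1%:~R, t.2%:~R)).
    congr rc_torus; apply/funext => w.
    by rewrite periodic_lift_translate agree_on_translate.
  have l1 : prob F xi @ \oo --> phi (cylinder F xi) by exact: lim.
  have := lim (translate_edges t F) (translate (- t) xi).
  rewrite -/(prob (translate_edges t F) (translate (- t) xi)) probE => l2.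
  exact: cvg_unique l2 l1.
have le t (A : set config) : measurable A ->
    (phi ((translate t : config -> config) @^-1` A) <= phi A)%E.
  move=> mA; rewrite -[leRHS]mul1e.
  apply: cylinder_domination => //; first exact: measurable_translate.
  by move=> F xi; rewrite mul1e cyl.
move=> t A mA; apply/eqP; rewrite eq_le le//=.
have -> : A = (translate (- t) : config -> config) @^-1`
    ((translate t : config -> config) @^-1` A).
  apply/funext => H /=; congr (A _); apply/funext => -[u d].
  by rewrite /translate /= addrK.
rewrite [leRHS](_ : _ = phi ((translate t : config -> config) @^-1` A)).
  by apply: le; rewrite -[X in measurable X]setTI; exact: measurable_translate.
congr (phi _); apply/funext => H /=; congr (A _); apply/funext => -[u d].
by rewrite /translate /= addrK.
Qed.

Lemma edge_mod_eventually_inj (s : nat -> nat) (e f : edge int) :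
  {homo s : i j / (i < j)%N} -> (forall k, (3 <= s k)%N) -> f != e ->
  \forall k \near \oo, edge_mod (s k) f != edge_mod (s k) e.
Proof.
move=> shomo s3 fe.
have sk k : (k <= s k)%N.
  by elim: k => // k IH; apply: leq_ltn_trans IH _; exact: shomo.
have int_mod (x y : int) : x != y -> \forall k \near \oo,
    (x%:~R : 'Z_(s k)) != y%:~R.
  move=> xy; exists `|x - y|%N.+1 => // k /= xyk.
  rewrite -subr_eq0 -intrB; have {xyk} := leq_trans xyk (sk k).
  have nat_mod m : (0 < m < s k)%N -> (m%:R : 'Z_(s k)) != 0.
    move=> /andP[m0 mk]; apply/eqP => /(congr1 val).
    by rewrite /= val_Zp_nat ?(leq_trans _ (s3 k))// modn_small// => m0'; rewrite m0' in m0.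
  have : x - y != 0 by rewrite subr_eq0.
  case: (x - y) => m m0 mk; last by rewrite NegzE mulrNz oppr_eq0; exact: nat_mod.
  by apply: nat_mod; rewrite mk andbT lt0n.
case: e f fe => [[e1 e2] d] [[f1 f2] d'] fe.
have [ne1|/negPn/eqP e1E] := boolP (f1 != e1).
  apply: filterS (int_mod _ _ ne1) => k; apply: contra => /eqP[h _ _].
  by apply/eqP.
have [ne2|/negPn/eqP e2E] := boolP (f2 != e2).
  apply: filterS (int_mod _ _ ne2) => k; apply: contra => /eqP[_ h _].
  by apply/eqP.
near=> k; apply: contra fe => /eqP[_ _ ->].
by rewrite e1E e2E.
Unshelve. all: by end_near.
Qed.

(** On the torus, the edge [e] must not be confused with another edge of the
    cylinder: this holds as soon as the torus is large enough. *)
Lemma weak_limit_set_edge (R : realType) (p q : R) phi e b :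
  0 < p -> p < 1 -> 0 < q -> rc_torus_weak_limit p q phi ->
  forall A : set config, measurable A ->
  (phi ((set_edge e b : config -> config) @^-1` A) <=
   (energy_bound p q)%:E * phi A)%E.
Proof.
move=> hp0 hp1 hq [s [shomo s3 lim]].
have K0 : 0 <= energy_bound p q.
  have r0 := ltW (edge_odds_gt0 hp0 hp1).
  by rewrite /energy_bound !mulr_ge0 ?addr_ge0 ?invr_ge0// ltW.
apply: cylinder_domination => //.
  apply: measurable_config_map => f; rewrite /set_edge.
  case: (f == e); first exact: measurable_event_const.
  exact: measurable_event_edge.
move=> F xi.
have [/andP[eF xe]|ok] := boolP ((e \in F) && (xi e != b)).
  rewrite (_ : _ @^-1` _ = set0) ?measure0 ?mule_ge0 ?lee_fin//.
  rewrite predeqE => H; split=> // /allP/(_ _ eF).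
  by rewrite /set_edge eqxx eq_sym (negbTE xe).
pose F' := [seq f <- F | f != e].
have -> : (set_edge e b : config -> config) @^-1` cylinder F xi =
    [set H : config | agree_on F' xi H].
  apply/seteqP; split => H /allP FH; apply/allP => f.
    rewrite mem_filter => /andP[fe /FH].
    by rewrite /set_edge (negbTE fe).
  move=> fF; rewrite /set_edge; have [fe|fe] := eqVneq f e.
    by move: ok; rewrite -fe fF /= negbK eq_sym.
  by apply: FH; rewrite mem_filter fe.
apply: (lee_cvg_to (lim F' xi) (cvgeZl _ (lim F xi))) => //.
have sep : \forall k \near \oo, forall f, f \in F' ->
    edge_mod (s k) f != edge_mod (s k) e.
  have : all (fun f => f != e) F' by exact: filter_all.
  elim: F' => [|f G IH] /= => [_|/andP[fe /IH sG]].
    by apply: nearW.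
  apply: filterS2 (edge_mod_eventually_inj shomo s3 fe) sG => k h1 h2 g.
  by rewrite inE => /orP[/eqP->//|]; exact: h2.
apply: filterS sep => k sepk; rewrite -EFinM lee_fin.
apply: (rc_torus_set (e := edge_mod (s k) e) (b := b)) => // w /allP Fw.
apply/allP => f fF; rewrite /periodic_lift ffunE.
have [fe|fe] := eqVneq f e.
  by rewrite fe eqxx; move: ok; rewrite -fe fF /= negbK eq_sym.
have fF' : f \in F' by rewrite mem_filter fe.
by rewrite (negbTE (sepk _ fF')); exact: Fw.
Qed.

Lemma weak_limit_finite_energy (R : realType) (p q : R) phi :
  0 < p -> p < 1 -> 0 < q -> rc_torus_weak_limit p q phi -> finite_energy phi.
Proof.
move=> hp0 hp1 hq lim.
have null e b (A : set config) : measurable A -> phi A = 0%E ->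
    phi ((set_edge e b : config -> config) @^-1` A) = 0%E.
  move=> mA A0; apply/eqP; rewrite -measure_le0.
  by have := weak_limit_set_edge e b hp0 hp1 hq lim mA; rewrite A0 mule0.
have meas lo lc (A : set config) : measurable A ->
    measurable ((edit lo lc : config -> config) @^-1` A).
  by move=> mA; rewrite -[X in measurable X]setTI; exact: measurable_edit.
elim=> [|e lo IH] lc A mA A0.
  elim: lc A mA A0 => [|e lc IH] A mA A0.
    by rewrite (_ : _ @^-1` _ = A)//; apply/funext => H /=; rewrite edit_nil.
  rewrite (_ : _ @^-1` _ = (edit [::] lc : config -> config) @^-1`
      ((set_edge e false : config -> config) @^-1` A)).
    apply: IH; last exact: null.
    rewrite (_ : _ @^-1` _ = (edit [::] [:: e] : config -> config) @^-1` A).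
      exact: meas.
    apply/funext => H /=; congr (A _); apply/funext => f.
    by rewrite /set_edge /edit /= inE; case: eqP.
  apply/funext => H /=; congr (A _); apply/funext => f.
  by rewrite /set_edge /edit /= inE; case: eqP.
rewrite (_ : _ @^-1` _ = (edit lo lc : config -> config) @^-1`
    ((set_edge e true : config -> config) @^-1` A)).
  apply: IH; last exact: null.
  rewrite (_ : _ @^-1` _ = (edit [:: e] [::] : config -> config) @^-1` A).
    exact: meas.
  apply/funext => H /=; congr (A _); apply/funext => f.
  by rewrite /set_edge /edit /= inE; case: eqP.
apply/funext => H /=; congr (A _); apply/funext => f.
by rewrite /set_edge /edit /= inE; case: eqP.
Qed.

Unset Implicit Arguments.
Set Strict Implicit.
Set Printing Implicit Defensive.

Theorem corollary3p1 (R : realType) (p q : R) (phi : probability config R)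
    (hp0 : 0 < p) (hp1 : p < 1) (hq : 0 < q)
    (hphi : rc_torus_weak_limit p q phi) :
  {ae phi, forall H : config,
    (nb_hp_infinite_clusters R H + nb_hp_infinite_clusters R (dual H) <= 1)%E}.
Proof.
apply: ae_nb_hp_infinite_clusters_le1; first exact: weak_limit_stationary hphi.
exact: weak_limit_finite_energy hphi.
Qed.
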